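(* Let $0<M<\dfrac{1}{2(\log 4-1)}$ and let $f=h+\overline{g}\in\mathcal{P}^{0}_{\mathcal{H}}(M)$ be given by $f(z)=z+\sum_{n=2}^{\infty}a_nz^n+\overline{\sum_{n=2}^{\infty}b_nz^n}$. Let $\{\varphi_n(r)\}_{n\ge 0}$ be a sequence of nonnegative increasing functions on $[0,1)$, differentiable in $(0,1)$, such that the series $\sum_{n=0}^{\infty}\varphi_n(r)$ converges locally uniformly with respect to $r\in[0,1)$, and $$\sum_{n=2}^{\infty}\frac{\varphi_n(0)}{n(n-1)}<\frac{1}{2M}+1-2\ln 2 .$$ Then the inequality $$r\varphi_0(r)+\sum_{n=2}^{\infty}\bigl(|a_n|+|b_n|\bigr)\varphi_n(r)\le d\bigl(f(0),\partial f(\mathbb{D})\bigr)$$ holds for all $|z|=r\le r_f(M)$, where $r_f(M)$ is the unique root in $(0,1)$ of the equation $$r\varphi_0(r)+2M\left(2\ln 2-1+\sum_{n=2}^{\infty}\frac{\varphi_n(r)}{n(n-1)}\right)-1=0 .$$ The radius $r_f(M)$ is best possible.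
   Context: $\mathbb{D}=\{z\in\mathbb{C}:|z|<1\}$. $\mathcal{H}_0$ is the class of complex-valued harmonic functions $f=h+\overline{g}$ in $\mathbb{D}$, with $h,g$ analytic in $\mathbb{D}$, normalized by $h(0)=h'(0)-1=0$ and $g(0)=g'(0)=0$; every such $f$ has the form $f(z)=z+\sum_{n=2}^{\infty}a_nz^n+\overline{\sum_{n=2}^{\infty}b_nz^n}$. For $M>0$, $$\mathcal{P}^{0}_{\mathcal{H}}(M)=\{f=h+\overline{g}\in\mathcal{H}_0:\operatorname{Re}(zh''(z))>-M+|zg''(z)|\ \text{for all } z\in\mathbb{D}\}.$$ $d(f(0),\partial f(\mathbb{D}))$ denotes the Euclidean distance between $f(0)$ and the boundary of $f(\mathbb{D})$, which is taken to be given by $d(f(0),\partial f(\mathbb{D}))=\liminf_{|z|\to1}|f(z)-f(0)|$. Both $\ln$ and $\log$ denote the natural logarithm. ''Best possible'' means that $r_f(M)$ cannot be replaced by any larger number with the inequality still holding for all $f\in\mathcal{P}^{0}_{\mathcal{H}}(M)$ and all $r$ up to that number.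
   Formalization: The root can fail to exist or be unique as printed: existence is proved if the φ_n are right-continuous at 0 and the left side is ≥ 0 somewhere in (0,1), uniqueness if φ_0(0)>0 or some φ_n (n≠1) is strictly increasing; the inequality and sharpness hold whenever the root is unique. *)

(* Defs.v *)
From Stdlib Require Import Reals.
From Coquelicot Require Import Coquelicot.
Open Scope R_scope.

Definition in_disk (z : C) : Prop := Cmod z < 1.

Definition analytic_on_disk (h : C -> C) : Prop :=
  forall z : C, in_disk z -> ex_derive h z.

Definition harmonic_map (h g : C -> C) (z : C) : C := (h z + Cconj (g z))%C.

(* [harmonic_map h g] belongs to H_0. *)
Definition in_H0 (h g : C -> C) : Prop :=
  analytic_on_disk h /\ analytic_on_disk g /\
  h 0%C = 0%C /\ C_derive h 0%C = 1%C /\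
  g 0%C = 0%C /\ C_derive g 0%C = 0%C.

(* [harmonic_map h g] belongs to P^0_H(M).  [C_derive] is a total function; it is
   the complex derivative wherever the latter exists, which is the case for
   h, g, h', g' throughout the disk since h and g are holomorphic there. *)
Definition in_PH0 (M : R) (h g : C -> C) : Prop :=
  in_H0 h g /\
  forall z : C, in_disk z ->
    Re (z * C_derive (C_derive h) z)%C
      > - M + Cmod (z * C_derive (C_derive g) z)%C.

(* The analytic and co-analytic parts are h(z) = z + sum_{n >= 2} a_n z^n and
   g(z) = sum_{n >= 2} b_n z^n in the disk; the entries of a and b of index 0
   and 1 are ignored. *)
Definition has_coefficients (h g : C -> C) (a b : nat -> C) : Prop :=
  forall z : C, in_disk z ->
    is_series (fun n => (a (n + 2)%nat * z ^ (n + 2))%C) (h z - z)%C /\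
    is_series (fun n => (b (n + 2)%nat * z ^ (n + 2))%C) (g z).

(* liminf of |f(z) - f(0)| as |z| -> 1, i.e. the supremum over s < 1 of the
   infimum over the annulus s < |z| < 1.  Each of these infima is finite, so
   taking the outer supremum over a set of real numbers loses nothing. *)
Definition dist_to_boundary (f : C -> C) : Rbar :=
  Lub_Rbar (fun m : R => exists s : R, 0 <= s < 1 /\
    Finite m =
      Glb_Rbar (fun x : R => exists z : C,
        s < Cmod z < 1 /\ x = Cmod (f z - f 0%C)%C)).

(* sum_{n >= 2} u_n *)
Definition ex_series2 (u : nat -> R) : Prop := ex_series (fun n => u (n + 2)%nat).
Definition Series2 (u : nat -> R) : R := Series (fun n => u (n + 2)%nat).

(* sum_{n >= 2} phi_n(r) / (n (n - 1)) *)
Definition weighted_sum (phi : nat -> R -> R) (r : R) : R :=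
  Series2 (fun n => phi n r / (INR n * (INR n - 1))).

(* Uniform convergence of the partial sums near every point of [0,1),
   relative to [0,1). *)
Definition series_cv_locally_uniformly (phi : nat -> R -> R) : Prop :=
  forall x : R, 0 <= x < 1 ->
    exists delta : posreal,
      CVU_dom (fun N r => sum_n (fun n => phi n r) N)
              (fun r => 0 <= r < 1 /\ Rabs (r - x) < delta).

Definition nondecreasing_on_01 (u : R -> R) : Prop :=
  forall r s : R, 0 <= r -> r <= s -> s < 1 -> u r <= u s.

Definition strictly_increasing_on_01 (u : R -> R) : Prop :=
  forall r s : R, 0 <= r -> r < s -> s < 1 -> u r < u s.

Definition radius_fun (M : R) (phi : nat -> R -> R) (r : R) : R :=
  r * phi 0%nat r + 2 * M * (2 * ln 2 - 1 + weighted_sum phi r) - 1.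

Definition radius_root (M : R) (phi : nat -> R -> R) (r : R) : Prop :=
  0 < r < 1 /\ radius_fun M phi r = 0.

(* The left-hand series has nonnegative terms, so the inequality includes its
   convergence. *)
Definition bohr_inequality
    (f : C -> C) (a b : nat -> C) (phi : nat -> R -> R) (r : R) : Prop :=
  ex_series2 (fun n => (Cmod (a n) + Cmod (b n)) * phi n r) /\
  Rbar_le
    (Finite (r * phi 0%nat r
             + Series2 (fun n => (Cmod (a n) + Cmod (b n)) * phi n r)))
    (dist_to_boundary f).

(* Main.v *)
Require Import Defs.
From Stdlib Require Import Reals Ranalysis5 Lra Lia.
From Coquelicot Require Import Coquelicot.
Open Scope R_scope.

(* For unimodular e the analytic function F = h + e g satisfies Re (z F'') > -M, so
   p = M + z F'' has nonnegative real part.  Integrating Re p against a nonnegative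
   trigonometric test function over circles gives both |p_n| <= 2 Re p_0 and the
   Harnack bound Re p(z) >= M (1 - |z|) / (1 + |z|).  The first bounds |a_n| + |b_n| by
   2M / (n (n - 1)), choosing e to align a_n and b_n; the second, integrated twice along
   the ray through z with e = (z / |z|)^2, gives
   |f(z)| >= |z| - 2M ((1 + |z|) ln (1 + |z|) - |z|), hence a distance to the boundary
   of at least 1 - 2M (2 ln 2 - 1).  Both bounds are attained by g = 0 and
   h'' = -2M / (1 + z), so the inequality fails wherever [radius_fun] is positive. *)

(** * Complex series and power series *)

(** Only trigonometric polynomials are ever integrated, and orthogonality turns the integral of a
    product of two of them into a finite pairing of coefficients. Two obstacles stand between this
    and power series. A truncation of a series with nonnegative real part may become negative, so a
    small constant is added to its constant term and removed in the limit. Absolute convergence on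
    the unit circle may fail, so p is replaced by its dilation w -> p(rho w), and rho tends to 1
    only in the final inequalities.

    The constant 2 ln 2 - 1 is the value of (1 + t) ln (1 + t) - t at t = 1, and the upper bound on
    M makes 1 - 2M (2 ln 2 - 1) positive.

    Differentiability on (0,1) does not control the jump of an increasing function at 0, so
    [radius_fun] can skip the value 0. It can also stay negative (all [phi n] zero) or vanish on a
    whole interval ([phi n] eventually constant). Hence existence of the root is derived from right
    continuity at 0 and a point where [radius_fun] is nonnegative, and uniqueness from a source of
    strict growth. The sharpness part uses uniqueness itself: beyond the only root a nondecreasing
    function is strictly positive. *)

Lemma Re_sum_n (a : nat -> C) (N : nat) :
  Re (sum_n a N) = sum_n (fun n => Re (a n)) N.
Proof.
  induction N as [|N IH]; [now rewrite !sum_O|].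
  now rewrite !sum_Sn, <- IH.
Qed.

Lemma Im_sum_n (a : nat -> C) (N : nat) :
  Im (sum_n a N) = sum_n (fun n => Im (a n)) N.
Proof.
  induction N as [|N IH]; [now rewrite !sum_O|].
  now rewrite !sum_Sn, <- IH.
Qed.

Lemma is_series_Re (a : nat -> C) (l : C) :
  is_series a l -> is_series (fun n => Re (a n)) (Re l).
Proof.
  intros H.
  apply (filterlim_ext (fun N => Re (sum_n a N)));
    [intros N; apply Re_sum_n|].
  apply filterlim_locally; intros eps.
  generalize (proj1 (filterlim_locally _ _) H eps).
  apply filter_imp; intros N [HN _]; exact HN.
Qed.

Lemma is_series_Im (a : nat -> C) (l : C) :
  is_series a l -> is_series (fun n => Im (a n)) (Im l).
Proof.
  intros H.
  apply (filterlim_ext (fun N => Im (sum_n a N)));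
    [intros N; apply Im_sum_n|].
  apply filterlim_locally; intros eps.
  generalize (proj1 (filterlim_locally _ _) H eps).
  apply filter_imp; intros N [_ HN]; exact HN.
Qed.

(** Total like [Series]: it is the sum only once convergence is known, which [Csum_correct] draws
    from absolute convergence. *)
Definition Csum (a : nat -> C) : C :=
  (Series (fun n => Re (a n)), Series (fun n => Im (a n))).

Lemma Csum_unique (a : nat -> C) (l : C) : is_series a l -> Csum a = l.
Proof.
  intros H; unfold Csum.
  rewrite (is_series_unique _ _ (is_series_Re _ _ H)).
  rewrite (is_series_unique _ _ (is_series_Im _ _ H)).
  now destruct l.
Qed.

Lemma Csum_correct (a : nat -> C) :
  ex_series (fun n => Cmod (a n)) -> is_series a (Csum a).
Proof.
  intros H.
  destruct (ex_series_le (V := C_CompleteNormedModule) a (fun n => Cmod (a n)))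
    as [l Hl]; [intros n; apply Rle_refl|exact H|].
  now rewrite (Csum_unique a l Hl).
Qed.

Lemma Cmod_sum_n_le (a : nat -> C) (N : nat) :
  Cmod (sum_n a N) <= sum_n (fun n => Cmod (a n)) N.
Proof.
  induction N as [|N IH]; [rewrite !sum_O; apply Rle_refl|].
  rewrite !sum_Sn.
  eapply Rle_trans; [apply Cmod_triangle|].
  now apply Rplus_le_compat_r.
Qed.

Lemma Cmod_series_le (a : nat -> C) (b : nat -> R) (l : C) :
  is_series a l -> (forall n, Cmod (a n) <= b n) -> ex_series b ->
  Cmod l <= Series b.
Proof.
  intros Ha Hab Hb.
  assert (Hl : is_lim_seq (fun N => Cmod (sum_n a N)) (Cmod l)).
  { apply (filterlim_comp _ _ _ (sum_n a) Cmod eventually (locally l)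
      (locally (Cmod l))); [exact Ha|].
    exact (@filterlim_norm C_AbsRing C_NormedModule l). }
  refine (is_lim_seq_le _ _ (Cmod l) (Series b) _ Hl (Series_correct b Hb)).
  intros N; eapply Rle_trans; [apply Cmod_sum_n_le|].
  induction N as [|N IH]; [rewrite !sum_O; apply Hab|].
  rewrite !sum_Sn; now apply Rplus_le_compat.
Qed.

Lemma is_series_C_ext (a b : nat -> C) (l : C) :
  (forall n, a n = b n) -> is_series a l -> is_series b l.
Proof. intros; now apply (is_series_ext a b l). Qed.

Lemma is_series_C_scal (c : C) (a : nat -> C) (l : C) :
  is_series a l -> is_series (fun n => c * a n)%C (c * l)%C.
Proof. exact (is_series_scal (K := C_AbsRing) (V := C_NormedModule) c a l). Qed.

Lemma is_series_C_plus (a b : nat -> C) (la lb : C) :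
  is_series a la -> is_series b lb -> is_series (fun n => a n + b n)%C (la + lb)%C.
Proof. exact (is_series_plus (K := C_AbsRing) (V := C_NormedModule) a b la lb). Qed.

Lemma is_series_C_shift (a : nat -> C) (l : C) :
  is_series (fun n => a (S n)) l <-> is_series a (a O + l)%C.
Proof.
  split; intros H.
  - apply (is_series_decr_1 (K := C_AbsRing) (V := C_NormedModule)).
    assert (E : l = (a O + l + - a O)%C) by ring.
    rewrite E in H; exact H.
  - apply (is_series_incr_1 (K := C_AbsRing) (V := C_NormedModule)).
    assert (E : (a O + l)%C = (l + a O)%C) by ring.
    rewrite E in H; exact H.
Qed.

Lemma is_series_Cgeom (w : C) :
  Cmod w < 1 -> is_series (fun n => w ^ n)%C (/ (1 - w))%C.
Proof.
  intros Hw.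
  assert (Hne : (1 - w)%C <> 0%C).
  { intros H; assert (w = 1%C) as -> by (replace w with (1 - (1 - w))%C by ring;
      rewrite H; ring).
    rewrite Cmod_1 in Hw; lra. }
  assert (HS : is_series (fun n => w ^ n)%C (Csum (fun n => w ^ n)%C)).
  { apply Csum_correct.
    apply (ex_series_ext (fun n => Cmod w ^ n)); [intros n; now rewrite Cmod_pow|].
    apply ex_series_geom; rewrite Rabs_pos_eq; [exact Hw|apply Cmod_ge_0]. }
  set (L := Csum _) in HS.
  (* Multiplying by w shifts the series by one place, which loses only its first term 1. *)
  assert (HL : (w * L = L - 1)%C).
  { assert (H1 : is_series (fun n => w ^ (S n))%C (L - 1)%C).
    { apply (is_series_C_shift (fun n => w ^ n)%C); simpl.
      replace (1 + (L - 1))%C with L by ring; exact HS. }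
    rewrite <- (Csum_unique _ _ H1).
    symmetry; apply Csum_unique.
    exact (is_series_C_scal w _ _ HS). }
  replace (/ (1 - w))%C with L; [exact HS|].
  assert (H1 : (L * (1 - w))%C = 1%C)
    by (transitivity (L - w * L)%C; [ring|rewrite HL; ring]).
  replace L with (L * (1 - w) * / (1 - w))%C by (field; exact Hne).
  rewrite H1; ring.
Qed.

(** The factor in front of |w - z|^2 does not depend on w, so these remainders can be summed against
    coefficients. For n = 0 the factor [INR n] makes the value of [pred 0] irrelevant. *)
Lemma Cpow_taylor_bound (R0 : R) (z w : C) (n : nat) :
  Cmod z <= R0 -> Cmod w <= R0 ->
  Cmod (w ^ (S n) - z ^ (S n) - INR (S n) * (w - z) * z ^ n)
  <= INR (S n) * INR n * R0 ^ (pred n) * Cmod (w - z) ^ 2.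
Proof.
  intros Hz Hw.
  assert (HR : 0 <= R0) by (eapply Rle_trans; [apply Cmod_ge_0|exact Hz]).
  induction n as [|n IH].
  - replace (w ^ 1 - z ^ 1 - INR 1 * (w - z) * z ^ 0)%C with (RtoC 0)
      by (cbn [Cpow INR]; ring).
    rewrite Cmod_0; simpl; lra.
  (* The next remainder is w times the present one plus (n + 1) (w - z)^2 z^n. *)
  - replace (w ^ S (S n) - z ^ S (S n) - INR (S (S n)) * (w - z) * z ^ S n)%C
      with (w * (w ^ (S n) - z ^ (S n) - INR (S n) * (w - z) * z ^ n)
            + INR (S n) * (w - z) * (w - z) * z ^ n)%C.
    2:{ rewrite (S_INR (S n)), RtoC_plus; cbn [Cpow]; ring. }
    eapply Rle_trans; [apply Cmod_triangle|].
    rewrite !Cmod_mult, Cmod_pow, Cmod_R, Rabs_pos_eq by apply pos_INR.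
    set (d := Cmod (w - z)) in *.
    assert (Hzn : Cmod z ^ n <= R0 ^ n)
      by (apply pow_incr; split; [apply Cmod_ge_0|exact Hz]).
    assert (Hd : 0 <= d) by apply Cmod_ge_0.
    assert (HSn := pos_INR (S n)).
    apply Rle_trans with
      (R0 * (INR (S n) * INR n * R0 ^ pred n * d ^ 2) + INR (S n) * d * d * R0 ^ n).
    + apply Rplus_le_compat.
      * apply Rmult_le_compat; [apply Cmod_ge_0|apply Cmod_ge_0|exact Hw|exact IH].
      * apply Rmult_le_compat_l; [|exact Hzn].
        apply Rmult_le_pos; [now apply Rmult_le_pos|exact Hd].
    + replace (pred (S n)) with n by reflexivity.
      assert (Hp : INR n * (R0 * R0 ^ pred n) = INR n * R0 ^ n)
        by (destruct n; simpl; ring).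
      replace (R0 * (INR (S n) * INR n * R0 ^ pred n * d ^ 2))
        with (INR (S n) * (INR n * (R0 * R0 ^ pred n)) * d ^ 2) by ring.
      rewrite Hp, (S_INR (S n)).
      assert (0 <= INR (S n) * R0 ^ n * d ^ 2)
        by (apply Rmult_le_pos; [apply Rmult_le_pos|]; try apply pow_le; auto).
      rewrite !S_INR in *; nra.
Qed.

(** Bounded terms at the midpoint of |x| and 1 push the radius of convergence strictly beyond
    |x|. *)
Lemma CV_radius_ge_1 (a : nat -> R) (x : R) :
  (forall y, 0 <= y < 1 -> exists B, forall n, Rabs (a n * y ^ n) <= B) ->
  Rabs x < 1 -> Rbar_lt (Rabs x) (CV_radius a).
Proof.
  intros Ha Hx.
  apply Rbar_lt_le_trans with ((Rabs x + 1) / 2); [simpl; lra|].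
  apply (proj1 (CV_radius_bounded a)).
  apply Ha; generalize (Rabs_pos x); lra.
Qed.

(** * Termwise complex differentiation of power series *)

Lemma locally_Cmod (z : C) (P : C -> Prop) (delta : R) :
  0 < delta -> (forall w, Cmod (w - z) < delta -> P w) ->
  locally (T := AbsRing_UniformSpace C_AbsRing) z P.
Proof.
  intros Hd HP.
  exists (mkposreal delta Hd); intros w Hw; apply HP; exact Hw.
Qed.

Lemma locally_in_disk (z : C) : 
  in_disk z -> locally (T := AbsRing_UniformSpace C_AbsRing) z in_disk.
Proof.
  unfold in_disk; intros Hz.
  apply (locally_Cmod z _ (1 - Cmod z)); [lra|].
  intros w Hw; replace w with (w - z + z)%C by ring.
  generalize (Cmod_triangle (w - z) z); lra.
Qed.

Lemma is_derive_C_quadratic (f : C -> C) (z l : C) (K delta : R) :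
  0 < delta ->
  (forall w, Cmod (w - z) < delta ->
    Cmod (f w - f z - (w - z) * l) <= K * Cmod (w - z) ^ 2) ->
  is_derive (K := C_AbsRing) (V := C_NormedModule) f z l.
Proof.
  intros Hd Hf.
  split; [apply is_linear_scal_l|].
  intros x Hx.
  rewrite <- (is_filter_lim_locally_unique (V := AbsRing_NormedModule C_AbsRing) _ _ Hx).
  intros eps.
  assert (HK : 0 < Rabs K + 1) by (generalize (Rabs_pos K); lra).
  assert (He := cond_pos eps).
  (* The sign of K is unknown; |K| + 1 is a positive bound for it. *)
  apply (locally_Cmod z _ (Rmin delta (eps / (Rabs K + 1)))).
  { apply Rmin_case; [exact Hd|]; now apply Rdiv_lt_0_compat. }
  intros w Hw.
  change (Cmod (f w - f z - (w - z) * l) <= eps * Cmod (w - z)).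
  assert (Hw1 := Rlt_le_trans _ _ _ Hw (Rmin_l _ _)).
  assert (Hw2 := Rlt_le_trans _ _ _ Hw (Rmin_r _ _)).
  eapply Rle_trans; [apply (Hf w Hw1)|].
  assert (H0 := Cmod_ge_0 (w - z)).
  set (d := Cmod (w - z)) in *.
  replace (K * d ^ 2) with ((K * d) * d) by ring.
  apply Rmult_le_compat_r; [exact H0|].
  apply Rlt_le in Hw2.
  apply (Rmult_le_compat_l (Rabs K + 1)) in Hw2; [|lra].
  replace ((Rabs K + 1) * (eps / (Rabs K + 1))) with (pos eps) in Hw2 by (field; lra).
  generalize (Rle_abs K); nra.
Qed.

(** Radius of convergence at least 1, in the pointwise strict form that [CV_disk_inside] and
    [is_derive_PSeries] take. Passing to moduli makes the theory of real power series available. *)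
Definition disk_summable (c : nat -> C) : Prop :=
  forall x, Rabs x < 1 -> Rbar_lt (Rabs x) (CV_radius (fun n => Cmod (c n))).

Definition CPS (c : nat -> C) (z : C) : C := Csum (fun n => c n * z ^ n)%C.

Definition CPS_derive (c : nat -> C) (n : nat) : C := (INR (S n) * c (S n))%C.

Lemma disk_summable_bounded (c : nat -> C) :
  (forall y, 0 <= y < 1 -> exists B, forall n, Cmod (c n) * y ^ n <= B) ->
  disk_summable c.
Proof.
  intros Hc x Hx; apply CV_radius_ge_1; [|exact Hx].
  intros y Hy; destruct (Hc y Hy) as [B HB]; exists B; intros n.
  rewrite Rabs_pos_eq; [apply HB|].
  apply Rmult_le_pos; [apply Cmod_ge_0|apply pow_le, Hy].
Qed.

(** Abel's argument: convergence at a real point y bounds the partial sums by some B, and each term,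
    being a difference of consecutive partial sums, by 2B. *)
Lemma disk_summable_of_ex_series (c : nat -> C) :
  (forall z, in_disk z ->
    exists l, is_series (K := C_AbsRing) (V := C_NormedModule)
                (fun n => c n * z ^ n)%C l) ->
  disk_summable c.
Proof.
  intros Hc; apply disk_summable_bounded; intros y Hy.
  destruct (Hc y) as [l Hl].
  { unfold in_disk; rewrite Cmod_R, Rabs_pos_eq; apply Hy. }
  destruct (filterlim_bounded (K := C_AbsRing) (V := C_NormedModule)
              (sum_n (fun n => c n * y ^ n)%C)) as [B HB]; [now exists l|].
  assert (HB' : forall N, Cmod (sum_n (fun n => c n * y ^ n)%C N) <= B) by exact HB.
  exists (2 * B); intros n.
  assert (H0 : 0 <= B) by (eapply Rle_trans; [apply Cmod_ge_0|apply (HB' O)]).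
  replace (Cmod (c n) * y ^ n) with (Cmod (c n * y ^ n)%C).
  2:{ now rewrite Cmod_mult, Cmod_pow, Cmod_R, Rabs_pos_eq by apply Hy. }
  destruct n as [|n].
  - specialize (HB' O); rewrite sum_O in HB'; lra.
  - assert (H1 := HB' n); assert (H2 := HB' (S n)).
    rewrite sum_Sn in H2; set (s := sum_n _ n) in *.
    replace (c (S n) * y ^ S n)%C
      with ((s + c (S n) * y ^ S n) + (- s))%C by ring.
    eapply Rle_trans; [apply Cmod_triangle|].
    rewrite Cmod_opp; change (plus s (c (S n) * y ^ S n)%C)
      with (s + c (S n) * y ^ S n)%C in H2; lra.
Qed.

Lemma ex_series_disk (c : nat -> C) (x : R) :
  disk_summable c -> 0 <= x < 1 -> ex_series (fun n => Cmod (c n) * x ^ n).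
Proof.
  intros Hc Hx.
  apply (ex_series_ext (fun n => Rabs (Cmod (c n) * x ^ n))).
  - intros n; apply Rabs_pos_eq.
    apply Rmult_le_pos; [apply Cmod_ge_0|apply pow_le, Hx].
  - apply CV_disk_inside, Hc; rewrite Rabs_pos_eq; apply Hx.
Qed.

Lemma CPS_correct (c : nat -> C) (z : C) :
  disk_summable c -> in_disk z -> is_series (fun n => c n * z ^ n)%C (CPS c z).
Proof.
  intros Hc Hz; apply Csum_correct.
  apply (ex_series_ext (fun n => Cmod (c n) * Cmod z ^ n));
    [intros n; now rewrite Cmod_mult, Cmod_pow|].
  apply ex_series_disk; [exact Hc|split; [apply Cmod_ge_0|exact Hz]].
Qed.

Lemma Cmod_CPS_derive (c : nat -> C) (n : nat) :
  Cmod (CPS_derive c n) = PS_derive (fun n => Cmod (c n)) n.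
Proof.
  unfold CPS_derive, PS_derive.
  now rewrite Cmod_mult, Cmod_R, Rabs_pos_eq by apply pos_INR.
Qed.

Lemma disk_summable_derive (c : nat -> C) :
  disk_summable c -> disk_summable (CPS_derive c).
Proof.
  intros Hc x Hx.
  rewrite (CV_radius_ext _ _ (Cmod_CPS_derive c)), CV_radius_derive.
  now apply Hc.
Qed.

Lemma is_derive_CPS (c : nat -> C) (z : C) :
  disk_summable c -> in_disk z ->
  is_derive (K := C_AbsRing) (V := C_NormedModule) (CPS c) z (CPS (CPS_derive c) z).
Proof.
  intros Hc Hz; assert (Hc' := disk_summable_derive c Hc).
  assert (Hc'' := disk_summable_derive _ Hc').
  unfold in_disk in Hz; assert (Hz0 := Cmod_ge_0 z).
  (* A radius strictly between |z| and 1, so that a whole neighbourhood of z stays in a smaller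
     disk. *)
  set (R0 := (1 + Cmod z) / 2).
  assert (HR : Cmod z < R0 < 1) by (unfold R0; lra).
  (* Up to its vanishing term at 0, this is the series of moduli for the second derivative at
     [R0]. *)
  set (b := fun n => INR (S n) * INR n * R0 ^ (pred n) * Cmod (c (S n))).
  assert (Hb : ex_series b).
  { apply ex_series_incr_1.
    apply (ex_series_ext (fun n => Cmod (CPS_derive (CPS_derive c) n) * R0 ^ n)).
    - intros n; unfold b, CPS_derive; rewrite !Cmod_mult, !Cmod_R.
      rewrite !Rabs_pos_eq by apply pos_INR; simpl pred.
      change (@eq R (INR (S n) * (INR (S (S n)) * Cmod (c (S (S n)))) * R0 ^ n)
        (INR (S (S n)) * INR (S n) * R0 ^ n * Cmod (c (S (S n))))); ring.
    - apply ex_series_disk; [exact Hc''|lra]. }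
  apply (is_derive_C_quadratic _ _ _ (Series b) (R0 - Cmod z)); [lra|].
  intros w Hw.
  assert (Hw1 : Cmod w < R0).
  { replace w with (w - z + z)%C by ring.
    generalize (Cmod_triangle (w - z) z); lra. }
  assert (Sw := CPS_correct c w Hc (Rlt_trans _ _ _ Hw1 (proj2 HR))).
  assert (Sz := CPS_correct c z Hc Hz).
  assert (Sd := CPS_correct _ z Hc' Hz).
  (* Dropping the constant term aligns the power of exponent n + 1 with the n-th term of the derived
     series. *)
  assert (S1 : forall u, is_series (fun n => c n * u ^ n)%C (CPS c u) ->
      is_series (fun n => c (S n) * u ^ (S n))%C (CPS c u - c O)%C).
  { intros u Hu; apply (is_series_C_shift (fun n => c n * u ^ n)%C).
    assert (E : (c O * u ^ 0 + (CPS c u - c O))%C = CPS c u) by (cbn [Cpow]; ring).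
    cbv beta; rewrite E; exact Hu. }
  assert (HS := is_series_C_plus _ _ _ _ (S1 w Sw)
    (is_series_C_plus _ _ _ _ (is_series_C_scal (- (1)) _ _ (S1 z Sz))
                              (is_series_C_scal (- (w - z)) _ _ Sd))).
  replace (CPS c w - CPS c z - (w - z) * CPS (CPS_derive c) z)%C
    with (CPS c w - c 0%nat + (- (1) * (CPS c z - c 0%nat)
           + - (w - z) * CPS (CPS_derive c) z))%C by ring.
  rewrite Rmult_comm, <- Series_scal_l.
  refine (Cmod_series_le _ _ _ HS _ _); [|now apply (ex_series_scal_l _ b)].
  intros n.
  replace (c (S n) * w ^ S n + (- (1) * (c (S n) * z ^ S n)
            + - (w - z) * (CPS_derive c n * z ^ n)))%C
    with (c (S n) * (w ^ (S n) - z ^ (S n) - INR (S n) * (w - z) * z ^ n))%C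
    by (unfold CPS_derive; ring).
  rewrite Cmod_mult; unfold b.
  replace (Cmod (w - z) ^ 2 * (INR (S n) * INR n * R0 ^ pred n * Cmod (c (S n))))
    with (Cmod (c (S n)) * (INR (S n) * INR n * R0 ^ pred n * Cmod (w - z) ^ 2)) by ring.
  apply Rmult_le_compat_l; [apply Cmod_ge_0|].
  apply Cpow_taylor_bound; lra.
Qed.

Lemma C_derive_CPS (c : nat -> C) (h : C -> C) :
  disk_summable c -> (forall z, in_disk z -> h z = CPS c z) ->
  forall z, in_disk z ->
    ex_derive (K := C_AbsRing) (V := C_NormedModule) h z /\
    C_derive h z = CPS (CPS_derive c) z.
Proof.
  intros Hc Hh z Hz.
  assert (H : is_derive (K := C_AbsRing) (V := C_NormedModule) h z
                (CPS (CPS_derive c) z)).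
  { apply (is_derive_ext_loc (CPS c)); [|now apply is_derive_CPS].
    generalize (locally_in_disk z Hz); apply filter_imp.
    intros w Hw; symmetry; now apply Hh. }
  split; [eexists; exact H|now apply is_C_derive_unique].
Qed.

Lemma C_derive2_CPS (c : nat -> C) (h : C -> C) (z : C) :
  disk_summable c -> (forall w, in_disk w -> h w = CPS c w) -> in_disk z ->
  C_derive (C_derive h) z = CPS (CPS_derive (CPS_derive c)) z.
Proof.
  intros Hc Hh Hz.
  refine (proj2 (C_derive_CPS _ _ (disk_summable_derive c Hc) _ z Hz)).
  intros w Hw; exact (proj2 (C_derive_CPS c h Hc Hh w Hw)).
Qed.
(** * Functions with nonnegative real part in the disk *)

Definition circ (t : R) : C := (cos t, sin t).

Lemma circ_pow (t : R) (n : nat) :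
  (circ t ^ n)%C = (cos (INR n * t), sin (INR n * t)).
Proof.
  induction n as [|n IH].
  - simpl; rewrite Rmult_0_l, cos_0, sin_0; reflexivity.
  - cbn [Cpow]; rewrite IH, S_INR.
    replace ((INR n + 1) * t) with (t + INR n * t) by ring.
    rewrite cos_plus, sin_plus; unfold circ, Cmult; simpl; f_equal; ring.
Qed.

Lemma Cmod_circ (t : R) : Cmod (circ t) = 1.
Proof.
  unfold Cmod, circ; simpl fst; simpl snd.
  replace (cos t ^ 2 + sin t ^ 2) with 1; [apply sqrt_1|].
  generalize (sin2_cos2 t); unfold Rsqr; intros; lra.
Qed.

Lemma is_RInt_trig_0 (m : nat) (al be : R) :
  m <> O ->
  is_RInt (fun t => al * cos (INR m * t) + be * sin (INR m * t)) 0 (2 * PI) 0.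
Proof.
  intros Hm.
  assert (Hm' : INR m <> 0) by now apply not_0_INR.
  set (F := fun t => (al * sin (INR m * t) - be * cos (INR m * t)) / INR m).
  assert (Hs : sin (INR m * PI) = 0).
  { apply sin_eq_0_1; exists (Z.of_nat m); now rewrite <- INR_IZR_INZ. }
  assert (E : minus (F (2 * PI)) (F 0) = 0 :> R).
  { unfold F; replace (INR m * (2 * PI)) with (2 * (INR m * PI)) by ring.
    replace (INR m * 0) with 0 by ring.
    rewrite sin_2a, cos_2a_sin, Hs, sin_0, cos_0.
    unfold minus, plus, opp; simpl; field; exact Hm'. }
  refine (eq_ind _ (is_RInt _ 0 (2 * PI)) _ _ E); apply (is_RInt_derive F).
  - intros t _; unfold F; auto_derive; [exact I|field; exact Hm'].
  - intros t _.
    apply (ex_derive_continuous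
      (fun t => al * cos (INR m * t) + be * sin (INR m * t))).
    auto_derive; exact I.
Qed.

(** Orthogonality on the circle. Frequency 0 is special because its factors are the constants Re p
    and Re q: imaginary parts disappear and no averaging halves the product. The values are arranged
    to share the factor [PI]. *)
Lemma is_RInt_circ_mult (p q : C) (j k : nat) :
  is_RInt (fun t => Re (p * circ t ^ j)%C * Re (q * circ t ^ k)%C) 0 (2 * PI)
    (if (j =? k)%nat then
       if (j =? 0)%nat then PI * (2 * (Re p * Re q)) else PI * Re (p * Cconj q)%C
     else 0).
Proof.
  (* Product-to-sum formulas leave only the frequencies m and 2j + m, both nonzero. *)
  assert (Hlt : forall (p q : C) (j m : nat), m <> O ->
    is_RInt (fun t => Re (p * circ t ^ j)%C * Re (q * circ t ^ (j + m))%C)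
      0 (2 * PI) 0).
  { clear; intros [p1 p2] [q1 q2] j m Hm.
    assert (H := is_RInt_plus _ _ _ _ _ _
      (is_RInt_trig_0 m ((p1 * q1 + p2 * q2) / 2) (- (p1 * q2 - p2 * q1) / 2) Hm)
      (is_RInt_trig_0 (j + (j + m))%nat
         ((p1 * q1 - p2 * q2) / 2) (- (p1 * q2 + p2 * q1) / 2) ltac:(lia))).
    match type of H with is_RInt _ _ _ ?v =>
      assert (E0 : v = 0) by exact (Rplus_0_l 0) end.
    rewrite E0 in H; clear E0.
    eapply is_RInt_ext; [|exact H].
    intros t _; rewrite !circ_pow.
    set (x := INR j * t); set (y := INR (j + m) * t).
    replace (INR m * t) with (y - x) by (unfold x, y; rewrite plus_INR; ring).
    replace (INR (j + (j + m)) * t) with (x + y)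
      by (unfold x, y; rewrite !plus_INR; ring).
    rewrite cos_minus, sin_minus, cos_plus, sin_plus.
    unfold plus; simpl; field. }
  destruct (Nat.lt_trichotomy j k) as [H|[H|H]].
  - rewrite (proj2 (Nat.eqb_neq j k)) by lia.
    replace k with (j + (k - j))%nat by lia; apply Hlt; lia.
  - subst k; rewrite Nat.eqb_refl.
    destruct (Nat.eqb_spec j 0) as [->|Hj].
    + assert (H := is_RInt_const 0 (2 * PI) (Re p * Re q)).
      match type of H with is_RInt _ _ _ ?v =>
        assert (E : v = PI * (2 * (Re p * Re q)))
          by (unfold scal; simpl; unfold mult; simpl; ring) end.
      rewrite E in H; eapply is_RInt_ext; [|exact H].
      intros t _; destruct p, q; simpl; ring.
    + clear Hlt; destruct p as [p1 p2], q as [q1 q2].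
      assert (H := is_RInt_plus _ _ _ _ _ _
        (is_RInt_const 0 (2 * PI) ((p1 * q1 + p2 * q2) / 2))
        (is_RInt_trig_0 (j + j)%nat
           ((p1 * q1 - p2 * q2) / 2) (- (p1 * q2 + p2 * q1) / 2) ltac:(lia))).
      match type of H with is_RInt _ _ _ ?v => 
        assert (E : v = PI * Re ((p1, p2) * Cconj (q1, q2))%C)
          by (unfold plus, scal; simpl; unfold mult; simpl; field) end.
      rewrite E in H; eapply is_RInt_ext; [|exact H].
      intros t _; rewrite !circ_pow.
      set (x := INR j * t).
      replace (INR (j + j) * t) with (x + x)
        by (unfold x; rewrite !plus_INR; ring).
      rewrite cos_plus, sin_plus.
      assert (Hsc := sin2_cos2 x); unfold Rsqr in Hsc.
      unfold plus; simpl.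
      transitivity ((p1 * q1 + p2 * q2) / 2 * (sin x * sin x + cos x * cos x) +
        ((p1 * q1 - p2 * q2) / 2 * (cos x * cos x - sin x * sin x) +
        - (p1 * q2 + p2 * q1) / 2 * (sin x * cos x + cos x * sin x))); [rewrite Hsc; ring|field].
  - rewrite (proj2 (Nat.eqb_neq j k)) by lia.
    apply (is_RInt_ext (fun t => Re (q * circ t ^ k)%C * Re (p * circ t ^ j)%C));
      [intros t _; apply Rmult_comm|].
    replace j with (k + (j - k))%nat by lia; apply Hlt; lia.
Qed.

Lemma is_RInt_sum_n (f : nat -> R -> R) (l : nat -> R) (a b : R) (N : nat) :
  (forall k, is_RInt (f k) a b (l k)) ->
  is_RInt (fun t => sum_n (fun k => f k t) N) a b (sum_n l N).
Proof.
  intros Hf; induction N as [|N IH].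
  - rewrite sum_O; apply (is_RInt_ext (f O)); [|apply Hf].
    intros t _; now rewrite sum_O.
  - rewrite sum_Sn.
    eapply is_RInt_ext; [|exact (is_RInt_plus _ _ _ _ _ _ IH (Hf (S N)))].
    intros t _; now rewrite sum_Sn.
Qed.

Lemma sum_n_kronecker (j N : nat) (x : R) :
  sum_n (fun k => if (j =? k)%nat then x else 0) N = if (j <=? N)%nat then x else 0.
Proof.
  induction N as [|N IH].
  - rewrite sum_O; now destruct j.
  - rewrite sum_Sn, IH; unfold plus; simpl.
    destruct (Nat.leb_spec j N), (Nat.eqb_spec j (S N)), (Nat.leb_spec j (S N));
      try lia; lra.
Qed.

(* The n-th contribution to twice the mean of [Re P * Re Q] over the unit circle, where
   P and Q are the power series with coefficients p and q. *)
Definition pairing_term (p q : nat -> C) (n : nat) : R :=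
  if (n =? 0)%nat then 2 * (Re (p n) * Re (q n)) else Re (p n * Cconj (q n))%C.

(** The product of the two nonnegative polynomials has a nonnegative integral, and orthogonality
    reduces its double sum to the diagonal. *)
Lemma trig_pairing_nonneg (p q : nat -> C) (N : nat) :
  (forall t, 0 <= sum_n (fun n => Re (p n * circ t ^ n)%C) N) ->
  (forall t, 0 <= sum_n (fun n => Re (q n * circ t ^ n)%C) N) ->
  0 <= sum_n (pairing_term p q) N.
Proof.
  intros Hp Hq.
  assert (HI : is_RInt (fun t => sum_n (fun n => Re (p n * circ t ^ n)%C) N *
                                 sum_n (fun n => Re (q n * circ t ^ n)%C) N)
                 0 (2 * PI) (PI * sum_n (pairing_term p q) N)).
  { assert (H := is_RInt_sum_n _ _ 0 (2 * PI) N (fun j =>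
      is_RInt_sum_n _ _ 0 (2 * PI) N (fun k => is_RInt_circ_mult (p j) (q k) j k))).
    match type of H with is_RInt _ _ _ ?v =>
      assert (E : v = PI * sum_n (pairing_term p q) N) end.
    { rewrite <- (sum_n_mult_l (K := R_Ring) PI).
      apply sum_n_ext_loc; intros j Hj.
      transitivity (sum_n (fun k => if (j =? k)%nat then PI * pairing_term p q j else 0) N).
      - apply sum_n_ext; intros k.
        destruct (Nat.eqb_spec j k) as [<-|]; [|reflexivity].
        unfold pairing_term; now destruct (Nat.eqb_spec j 0) as [->|].
      - rewrite sum_n_kronecker; now destruct (Nat.leb_spec j N); [|lia]. }
    rewrite E in H; eapply is_RInt_ext; [|exact H].
    intros t _; cbv beta.
    rewrite <- (sum_n_mult_r (K := R_Ring)).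
    apply sum_n_ext; intros j.
    now rewrite <- (sum_n_mult_l (K := R_Ring)). }
  assert (HPI := PI_RGT_0).
  assert (H0 : 0 <= PI * sum_n (pairing_term p q) N).
  { rewrite <- (is_RInt_unique _ _ _ _ HI).
    apply RInt_ge_0; [lra|eexists; exact HI|].
    intros t _; now apply Rmult_le_pos. }
  apply (Rmult_le_reg_l PI); lra.
Qed.

(** * From trigonometric polynomials to power series *)

Lemma sum_n_le_Series (a : nat -> R) (N : nat) :
  (forall n, 0 <= a n) -> ex_series a -> sum_n a N <= Series a.
Proof.
  intros Ha Hs.
  refine (is_lim_seq_le_loc (fun _ => sum_n a N) (sum_n a) (sum_n a N) (Series a) _
            (is_lim_seq_const _) (Series_correct a Hs)).
  exists N; intros n Hn; induction Hn as [|n Hn IH]; [apply Rle_refl|].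
  rewrite sum_Sn; unfold plus; simpl; specialize (Ha (S n)); lra.
Qed.

(** The tail of a is at most the tail of b, since b - a has nonnegative terms. *)
Lemma sum_n_lower (a b : nat -> R) (N : nat) :
  (forall n, Rabs (a n) <= b n) -> ex_series b ->
  Series a - (Series b - sum_n b N) <= sum_n a N.
Proof.
  intros Hab Hb.
  assert (Ha : ex_series a) by now apply (ex_series_le (V := R_CompleteNormedModule) a b).
  assert (H : sum_n (fun n => b n - a n) N <= Series (fun n => b n - a n)).
  { apply sum_n_le_Series; [|now apply (ex_series_minus b a)].
    intros n; generalize (Rle_abs (a n)) (Hab n); lra. }
  rewrite Series_minus in H by assumption.
  assert (E : sum_n (fun n => b n - a n) N = sum_n b N - sum_n a N).
  { clear H; induction N as [|N IH]; [now rewrite !sum_O|].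
    rewrite !sum_Sn, IH; unfold plus; simpl; ring. }
  lra.
Qed.

Definition shift_const (e : R) (p : nat -> C) (n : nat) : C :=
  if (n =? 0)%nat then (p n + e)%C else p n.

(* Adding e to the constant coefficient absorbs the tail of the series. *)
Lemma trig_shift_nonneg (p : nat -> C) (e : R) :
  ex_series (fun n => Cmod (p n)) ->
  (forall t, 0 <= Re (Csum (fun n => p n * circ t ^ n)%C)) -> 0 < e ->
  eventually (fun N =>
    forall t, 0 <= sum_n (fun n => Re (shift_const e p n * circ t ^ n)%C) N).
Proof.
  intros Hs Hp He.
  generalize (proj2 (is_lim_seq_spec _ (Finite (Series (fun n => Cmod (p n)))))
             (Series_correct _ Hs) (mkposreal e He)).
  apply filter_imp; intros N HN t.
  change (Rabs (sum_n (fun n => Cmod (p n)) N - Series (fun n => Cmod (p n))) < e) in HN.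
  assert (E : sum_n (fun n => Re (shift_const e p n * circ t ^ n)%C) N
              = sum_n (fun n => Re (p n * circ t ^ n)%C) N + e).
  { clear HN; induction N as [|N IH].
    - rewrite !sum_O; unfold shift_const; simpl; ring.
    - rewrite !sum_Sn, IH; unfold shift_const; simpl (S N =? 0)%nat; unfold plus; simpl; ring. }
  rewrite E.
  assert (Hterm : forall n, Rabs (Re (p n * circ t ^ n)%C) <= Cmod (p n)).
  { intros n; eapply Rle_trans; [apply re_le_Cmod|].
    rewrite Cmod_mult, Cmod_pow, Cmod_circ, pow1; lra. }
  assert (H := sum_n_lower _ _ N Hterm Hs).
  specialize (Hp t); apply Rabs_def2 in HN.
  change (0 <= Series (fun n => Re (p n * circ t ^ n)%C)) in Hp.
  lra.
Qed.

(** With e added to both constant terms, long truncations are nonnegative and the polynomial case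
    applies; then N tends to infinity and e to 0. *)
Lemma pairing_nonneg (p q : nat -> C) :
  ex_series (fun n => Cmod (p n)) -> ex_series (fun n => Cmod (q n)) ->
  (forall t, 0 <= Re (Csum (fun n => p n * circ t ^ n)%C)) ->
  (forall t, 0 <= Re (Csum (fun n => q n * circ t ^ n)%C)) ->
  0 <= Series (pairing_term p q).
Proof.
  intros Hsp Hsq Hp Hq.
  assert (Hex : ex_series (pairing_term p q)).
  { destruct (filterlim_bounded (K := R_AbsRing) (V := R_NormedModule)
      (fun n => Cmod (q n))) as [B HB].
    { exists 0; exact (ex_series_lim_0 _ Hsq). }
    assert (HB' : forall n, Cmod (q n) <= B).
    { intros n; specialize (HB n); unfold norm in HB; simpl in HB; unfold abs in HB;
      simpl in HB; rewrite Rabs_pos_eq in HB; [exact HB|apply Cmod_ge_0]. }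
    apply ex_series_incr_1.
    apply (ex_series_le (V := R_CompleteNormedModule) _ (fun n => B * Cmod (p (S n)))).
    - intros n; change (Rabs (Re (p (S n) * Cconj (q (S n)))%C) <= B * Cmod (p (S n))).
      eapply Rle_trans; [apply re_le_Cmod|].
      rewrite Cmod_mult, Cmod_conj, Rmult_comm.
      apply Rmult_le_compat_r; [apply Cmod_ge_0|apply HB'].
    - apply (ex_series_scal_l B (fun n => Cmod (p (S n)))).
      now apply (ex_series_incr_1 (fun n => Cmod (p n))). }
  set (X := Series (pairing_term p q)).
  set (Y := Re (p O) + Re (q O)).
  (* Shifting both constant coefficients by e changes only the pairing term at 0, by exactly 2eY +
     2e^2. *)
  assert (Heps : forall e, 0 < e -> 0 <= X + 2 * e * Y + 2 * (e * e)).
  { intros e He.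
    refine (is_lim_seq_le_loc (fun _ => 0)
      (fun N => sum_n (pairing_term p q) N + (2 * e * Y + 2 * (e * e))) 0
      (X + 2 * e * Y + 2 * (e * e)) _ (is_lim_seq_const 0) _).
    - generalize (filter_and _ _ (trig_shift_nonneg p e Hsp Hp He)
                   (trig_shift_nonneg q e Hsq Hq He)).
      apply filter_imp; intros N [H1 H2].
      replace (sum_n (pairing_term p q) N + (2 * e * Y + 2 * (e * e)))
        with (sum_n (pairing_term (shift_const e p) (shift_const e q)) N);
        [now apply trig_pairing_nonneg|].
      clear H1 H2; induction N as [|N IH].
      + rewrite !sum_O; unfold pairing_term, shift_const, Y; cbn [Nat.eqb].
        rewrite !re_plus, !re_RtoC.
        match goal with |- @eq _ ?x ?y => change (@eq R x y) end; ring.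
      + rewrite !sum_Sn, IH; unfold pairing_term, shift_const; simpl (S N =? 0)%nat.
        unfold plus; simpl; ring.
    - replace (X + 2 * e * Y + 2 * (e * e)) with (X + (2 * e * Y + 2 * (e * e))) by ring.
      apply (is_lim_seq_plus' _ _ X); [exact (Series_correct _ Hex)|apply is_lim_seq_const]. }
  destruct (Rle_or_lt 0 X) as [H|H]; [exact H|exfalso].
  set (K := 2 * Rabs Y + 2).
  assert (HK : 0 < K) by (unfold K; generalize (Rabs_pos Y); lra).
  (* Since e <= 1, the perturbation is at most eK <= -X/2, which leaves at most X/2 < 0. *)
  set (e := Rmin 1 (- X / 2 / K)).
  assert (He : 0 < e).
  { unfold e; apply Rmin_case; [lra|apply Rdiv_lt_0_compat; lra]. }
  assert (He1 : e <= 1) by apply Rmin_l.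
  assert (He2 : e * K <= - X / 2).
  { replace (- X / 2) with (- X / 2 / K * K) by (field; lra).
    apply Rmult_le_compat_r; [lra|apply Rmin_r]. }
  specialize (Heps e He); unfold K in He2.
  generalize (Rle_abs Y); nra.
Qed.

(** * The coefficient bound of Caratheodory and the inequality of Harnack *)

Lemma is_series_single (k : nat) (x : C) :
  is_series (fun n => if (n =? k)%nat then x else RtoC 0) x.
Proof.
  apply (filterlim_ext_loc (fun _ => x)); [|apply filterlim_const].
  exists k; intros N HN.
  assert (E : forall N, sum_n (fun n => if (n =? k)%nat then x else RtoC 0) N
     = if (k <=? N)%nat then x else RtoC 0).
  { clear; intros N; induction N as [|N IH].
    - rewrite sum_O; now destruct k.
    - rewrite sum_Sn, IH.
      destruct (Nat.leb_spec k N), (Nat.eqb_spec (S N) k), (Nat.leb_spec k (S N)); try lia;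
        [change ((x + 0)%C = x)|change ((0 + x)%C = x)|change ((0 + 0)%C = RtoC 0)]; ring. }
  rewrite E; destruct (Nat.leb_spec k N); [reflexivity|lia].
Qed.

(** The real part is the Poisson kernel (1 - |w|^2) / |1 - w|^2, smallest at w = -|w|; with
    denominators cleared, the claim reduces to Re w >= -|w|. *)
Lemma Re_mobius (w : C) :
  Cmod w < 1 -> (1 - Cmod w) / (1 + Cmod w) <= Re ((1 + w) / (1 - w))%C.
Proof.
  intros Hw.
  assert (H0 := Cmod_ge_0 w).
  assert (H2 := Cmod2_alt w).
  assert (Hr := re_le_Cmod w).
  set (r := Cmod w) in *; clearbody r; destruct w as [x y]; simpl in H2, Hr.
  assert (E2 : r * r = x * x + y * y) by lra.
  apply Rabs_le_between in Hr.
  assert (Hd : 0 < (1 - x) * (1 - x) + y * y) by nra.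
  replace (Re ((1 + (x, y)) / (1 - (x, y)))%C)
    with ((1 - r * r) / ((1 - x) * (1 - x) + y * y)).
  2:{ rewrite E2; simpl; field; nra. }
  apply Rmult_le_reg_r with ((1 + r) * ((1 - x) * (1 - x) + y * y)); [nra|].
  replace ((1 - r) / (1 + r) * ((1 + r) * ((1 - x) * (1 - x) + y * y)))
    with ((1 - r) * (1 - 2 * x + r * r)) by (rewrite E2; field; lra).
  replace ((1 - r * r) / ((1 - x) * (1 - x) + y * y) * ((1 + r) * ((1 - x) * (1 - x) + y * y)))
    with ((1 - r) * (1 + r) ^ 2) by (field; lra).
  apply Rmult_le_compat_l; nra.
Qed.
Lemma unit_factor (z : C) : exists u : C, Cmod u = 1 /\ z = (Cmod z * u)%C.
Proof.
  destruct (Ceq_dec z 0) as [->|Hz].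
  - exists (RtoC 1); rewrite Cmod_1, Cmod_0; split; [reflexivity|ring].
  - assert (H := proj1 (Cmod_gt_0 z) Hz).
    assert (Hne : RtoC (Cmod z) <> 0%C) by (intros E; apply RtoC_inj in E; lra).
    exists (z / Cmod z)%C; split.
    + rewrite Cmod_div, Cmod_R, Rabs_pos_eq by (try exact Hne; lra).
      field; lra.
    + field; exact Hne.
Qed.

Lemma Cunit_conj (u : C) : Cmod u = 1 -> (u * Cconj u)%C = 1%C.
Proof. intros H; rewrite <- Cmod2_conj, H; f_equal; ring. Qed.

Lemma Cconj_RtoC (x : R) : Cconj x = x.
Proof. apply injective_projections; simpl; ring. Qed.

Lemma Csum_ext (a b : nat -> C) : (forall n, a n = b n) -> Csum a = Csum b.
Proof.
  intros H; unfold Csum; f_equal; apply Series_ext; intros n; now rewrite H.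
Qed.

Lemma dilation_on_circle (p : nat -> C) (rho t : R) :
  Csum (fun n => p n * rho ^ n * circ t ^ n)%C = CPS p (rho * circ t)%C.
Proof. apply Csum_ext; intros n; rewrite Cpow_mult_l; ring. Qed.

(** Provides the absolute summability on the unit circle that [pairing_nonneg] asks for. *)
Lemma dilation_summable (p : nat -> C) (rho : R) :
  disk_summable p -> 0 <= rho < 1 -> ex_series (fun n => Cmod (p n * rho ^ n)%C).
Proof.
  intros Hp Hr; apply (ex_series_ext (fun n => Cmod (p n) * rho ^ n));
    [|now apply ex_series_disk].
  intros n; now rewrite Cmod_mult, Cmod_pow, Cmod_R, Rabs_pos_eq by apply Hr.
Qed.

Lemma in_disk_dilation (rho t : R) : 0 <= rho < 1 -> in_disk (rho * circ t)%C.
Proof.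
  intros Hr; unfold in_disk.
  rewrite Cmod_mult, Cmod_circ, Cmod_R, Rabs_pos_eq; lra.
Qed.

Lemma is_series_single_R (k : nat) (x : R) :
  is_series (fun n => if (n =? k)%nat then x else 0) x.
Proof.
  apply (is_series_ext (fun n => Re (if (n =? k)%nat then RtoC x else RtoC 0))).
  - intros n; now destruct (n =? k)%nat.
  - exact (is_series_Re _ _ (is_series_single k (RtoC x))).
Qed.

(* The test function is [1 + tau w^k] with [tau] opposite to the argument of [p k]. *)
Lemma caratheodory_coefficient_dilated (p : nat -> C) (k : nat) (rho : R) :
  disk_summable p -> (forall z, in_disk z -> 0 <= Re (CPS p z)) ->
  k <> O -> 0 <= rho < 1 -> Cmod (p k) * rho ^ k <= 2 * Re (p O).
Proof.
  intros Hp Hpos Hk Hrho.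
  destruct (unit_factor (p k)) as [u [Hu Hpk]].
  set (q := fun n => ((if (n =? 0)%nat then RtoC 1 else RtoC 0)
                      + (if (n =? k)%nat then - u else RtoC 0))%C).
  assert (H : 0 <= Series (pairing_term (fun n => p n * rho ^ n)%C q)).
  { apply pairing_nonneg.
    - now apply dilation_summable.
    - apply (ex_series_le (V := R_CompleteNormedModule) _
        (fun n => (if (n =? 0)%nat then 1 else 0) + (if (n =? k)%nat then 1 else 0))).
      + intros n; change (Rabs (Cmod (q n)) <= (if (n =? 0)%nat then 1 else 0)
          + (if (n =? k)%nat then 1 else 0)).
        rewrite Rabs_pos_eq by apply Cmod_ge_0.
        unfold q; eapply Rle_trans; [apply Cmod_triangle|].
        destruct (n =? 0)%nat, (n =? k)%nat;
          rewrite ?Cmod_opp, ?Hu, ?Cmod_0, ?Cmod_1; lra.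
      + eexists; apply (is_series_plus (V := R_NormedModule));
          apply is_series_single_R.
    - intros t; rewrite dilation_on_circle; now apply Hpos, in_disk_dilation.
    - intros t.
      assert (HS : is_series (fun n => q n * circ t ^ n)%C (1 + - u * circ t ^ k)%C).
      { eapply is_series_C_ext;
          [|exact (is_series_C_plus _ _ _ _ (is_series_single 0 (RtoC 1))
                     (is_series_single k (- u * circ t ^ k)%C))].
        intros n; cbv beta; unfold q.
        destruct (Nat.eqb_spec n 0) as [E0|], (Nat.eqb_spec n k) as [Ek|];
          try lia; rewrite ?E0, ?Ek; cbn [Cpow]; ring. }
      rewrite (Csum_unique _ _ HS), re_plus, re_RtoC.
      assert (Hre := re_le_Cmod (- u * circ t ^ k)%C).
      rewrite Cmod_mult, Cmod_opp, Hu, Cmod_pow, Cmod_circ, pow1 in Hre.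
      apply Rabs_le_between in Hre; lra. }
  (* Only the indices 0 and k survive, and p_k times the conjugate of -u is -|p_k|. *)
  assert (HS : is_series (pairing_term (fun n => p n * rho ^ n)%C q)
                 (2 * Re (p O) + - (Cmod (p k) * rho ^ k))).
  { eapply is_series_ext;
      [|exact (is_series_plus (V := R_NormedModule) _ _ _ _
                (is_series_single_R 0 (2 * Re (p O)))
                (is_series_single_R k (- (Cmod (p k) * rho ^ k))))].
    intros n; unfold pairing_term, q.
    destruct (Nat.eqb_spec n 0) as [->|].
    - rewrite (proj2 (Nat.eqb_neq 0 k)) by lia.
      unfold plus; simpl; destruct (p O); simpl; ring.
    - destruct (Nat.eqb_spec n k) as [->|].
      + replace (p k * rho ^ k * Cconj (0 + - u))%C
          with (RtoC (- (Cmod (p k) * rho ^ k))).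
        * rewrite re_RtoC; unfold plus; simpl; ring.
        * rewrite Hpk at 2.
          rewrite Cplus_0_l, Copp_conj.
          rewrite RtoC_opp, RtoC_mult, RtoC_pow.
          transitivity (- (Cmod (p k) * rho ^ k * (u * Cconj u)))%C;
            [rewrite Cunit_conj by exact Hu; ring|ring].
      + rewrite Cplus_0_r, Cconj_RtoC, Cmult_0_r; unfold plus; simpl; ring. }
  rewrite (is_series_unique _ _ HS) in H; lra.
Qed.

(** Carries inequalities to the endpoint 1, both for the dilation parameter and for the radius in
    the distance to the boundary. *)
Lemma le_at_1 (f : R -> R) (a K : R) :
  a < 1 -> continuity_pt f 1 -> (forall x, a < x < 1 -> f x <= K) -> f 1 <= K.
Proof.
  intros Ha Hf HK.
  destruct (Rle_or_lt (f 1) K) as [H|H]; [exact H|exfalso].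
  destruct (Hf (f 1 - K)) as [d [Hd Hfd]]; [lra|].
  set (x := Rmax ((a + 1) / 2) (1 - d / 2)).
  assert (Hx1 : (a + 1) / 2 <= x) by apply Rmax_l.
  assert (Hx2 : 1 - d / 2 <= x) by apply Rmax_r.
  assert (Hx3 : x < 1) by (unfold x; apply Rmax_case; lra).
  specialize (HK x ltac:(lra)).
  assert (Hb := Hfd x); simpl in Hb; unfold R_dist in Hb.
  assert (Hc : Rabs (f x - f 1) < f 1 - K).
  { apply Hb; split; [split; [exact I|lra]|].
    rewrite Rabs_left; lra. }
  apply Rabs_def2 in Hc; lra.
Qed.

Lemma caratheodory_coefficient (p : nat -> C) (k : nat) :
  disk_summable p -> (forall z, in_disk z -> 0 <= Re (CPS p z)) ->
  k <> O -> Cmod (p k) <= 2 * Re (p O).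
Proof.
  intros Hp Hpos Hk.
  replace (Cmod (p k)) with (Cmod (p k) * 1 ^ k) by (rewrite pow1; ring).
  apply (le_at_1 (fun x => Cmod (p k) * x ^ k) 0); [lra|reg|].
  intros x Hx; apply caratheodory_coefficient_dilated; auto; lra.
Qed.

(* The test function is [(1 + w) / (1 - w) - m] with [m] its minimal real part on the
   circle [Cmod w = r / rho]; its pairing with [p] evaluates [p] at [z]. *)
Lemma harnack_dilated (p : nat -> C) (z : C) (rho : R) :
  disk_summable p -> (forall w, in_disk w -> 0 <= Re (CPS p w)) ->
  Cmod z < rho < 1 ->
  (rho - Cmod z) / (rho + Cmod z) * Re (p O) <= Re (CPS p z).
Proof.
  intros Hp Hpos Hrho.
  destruct (unit_factor z) as [u [Hu Hz]].
  assert (Hr := Cmod_ge_0 z); set (r := Cmod z) in *.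
  (* Chosen so that z = rho s u: geometric coefficients of ratio s times the conjugate of u, paired
     with the dilated series, then evaluate p at z. *)
  set (s := r / rho).
  assert (Hs : 0 <= s < 1).
  { unfold s; split; [apply Rdiv_le_0_compat; lra|].
    apply Rmult_lt_reg_r with rho; [lra|]; unfold Rdiv.
    rewrite Rmult_assoc, Rinv_l; lra. }
  assert (Hsr : rho * s = r) by (unfold s; field; lra).
  set (m := (1 - s) / (1 + s)).
  assert (Hm : (rho - r) / (rho + r) = m).
  { unfold m; rewrite <- Hsr; field; split; nra. }
  rewrite Hm.
  (* The expansion of (1 + w) / (1 - w) - m is 2 w^n for n > 0 with constant term 1 - m, written
     here as 2 - (1 + m). *)
  set (q := fun n => (2 * (s * Cconj u) ^ n
                      + if (n =? 0)%nat then RtoC (- (1 + m)) else RtoC 0)%C).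
  assert (Hsu : Cmod (s * Cconj u)%C = s).
  { rewrite Cmod_mult, Cmod_conj, Hu, Cmod_R, Rabs_pos_eq; lra. }
  assert (H : 0 <= Series (pairing_term (fun n => p n * rho ^ n)%C q)).
  { apply pairing_nonneg.
    - apply dilation_summable; [exact Hp|lra].
    - apply (ex_series_le (V := R_CompleteNormedModule) _
        (fun n => 2 * s ^ n + (if (n =? 0)%nat then Rabs (1 + m) else 0))).
      + intros n; change (Rabs (Cmod (q n)) <= 2 * s ^ n
          + (if (n =? 0)%nat then Rabs (1 + m) else 0)).
        rewrite Rabs_pos_eq by apply Cmod_ge_0.
        unfold q; eapply Rle_trans; [apply Cmod_triangle|].
        rewrite Cmod_mult, Cmod_pow, Hsu, Cmod_R, (Rabs_pos_eq 2) by lra.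
        destruct (n =? 0)%nat; rewrite Cmod_R, ?Rabs_Ropp, ?Rabs_R0; lra.
      + apply (ex_series_plus (V := R_NormedModule)).
        * apply (ex_series_scal_l 2 (fun n => s ^ n)), ex_series_geom.
          rewrite Rabs_pos_eq; lra.
        * eexists; apply is_series_single_R.
    - intros t; rewrite dilation_on_circle; apply Hpos, in_disk_dilation; lra.
    - intros t.
      set (w := (s * Cconj u * circ t)%C).
      assert (Hw : Cmod w = s) by (unfold w; rewrite Cmod_mult, Hsu, Cmod_circ; ring).
      assert (Hne : (1 - w)%C <> 0%C).
      { intros E; assert (w = 1%C) as Ew by (replace w with (1 - (1 - w))%C by ring;
          rewrite E; ring).
        rewrite Ew, Cmod_1 in Hw; lra. }
      assert (HS : is_series (fun n => q n * circ t ^ n)%C ((1 + w) / (1 - w) + - m)%C).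
      { replace ((1 + w) / (1 - w) + - m)%C with (2 * / (1 - w) + RtoC (- (1 + m)))%C
          by (rewrite RtoC_opp, RtoC_plus; field; exact Hne).
        eapply is_series_C_ext;
          [|exact (is_series_C_plus _ _ _ _
                     (is_series_C_scal 2 _ _ (is_series_Cgeom w ltac:(lra)))
                     (is_series_single 0 (RtoC (- (1 + m)))))].
        intros n; cbv beta; unfold q, w; rewrite Cpow_mult_l.
        destruct (Nat.eqb_spec n 0) as [->|]; cbn [Cpow]; ring. }
      rewrite (Csum_unique _ _ HS), re_plus, <- RtoC_opp, re_RtoC.
      assert (Hre := Re_mobius w ltac:(lra)); rewrite Hw in Hre; fold m in Hre; lra. }
  assert (HS : is_series (pairing_term (fun n => p n * rho ^ n)%C q)
                 (2 * Re (CPS p z) + - (2 * m * Re (p O)))).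
  { eapply is_series_ext;
      [|exact (is_series_plus (V := R_NormedModule) _ _ _ _
                (is_series_scal_l 2 _ _ (is_series_Re _ _
                   (CPS_correct p z Hp (Rlt_trans _ _ _ (proj1 Hrho) (proj2 Hrho)))))
                (is_series_single_R 0 (- (2 * m * Re (p O)))))].
    intros n; unfold pairing_term, q.
    destruct (Nat.eqb_spec n 0) as [->|Hn].
    - cbn [Cpow]; rewrite !Cmult_1_r, re_plus, !re_RtoC.
      unfold plus, scal; simpl; unfold mult; simpl; ring.
    - replace (p n * rho ^ n * Cconj (2 * (s * Cconj u) ^ n + 0))%C
        with (RtoC 2 * (p n * z ^ n))%C.
      + rewrite re_scal_l; unfold plus, scal; simpl; unfold mult; simpl; ring.
      + replace (2 * (s * Cconj u) ^ n + 0)%C with (2 * (s * Cconj u) ^ n)%C by ring.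
        rewrite Cmult_conj, Cpow_conj, Cmult_conj, Cconj_conj.
        rewrite !Cconj_RtoC.
        rewrite Hz, <- Hsr, RtoC_mult, !Cpow_mult_l; ring. }
  rewrite (is_series_unique _ _ HS) in H; lra.
Qed.

Lemma harnack (p : nat -> C) (z : C) :
  disk_summable p -> (forall w, in_disk w -> 0 <= Re (CPS p w)) -> in_disk z ->
  (1 - Cmod z) / (1 + Cmod z) * Re (p O) <= Re (CPS p z).
Proof.
  intros Hp Hpos Hz; unfold in_disk in Hz; assert (H0 := Cmod_ge_0 z).
  apply (le_at_1 (fun x => (x - Cmod z) / (x + Cmod z) * Re (p O)) (Cmod z) _ Hz).
  - reg; lra.
  - intros x Hx; now apply harnack_dilated.
Qed.
(** * Coefficient and growth bounds *)

Lemma CPS_unique (c : nat -> C) (z l : C) :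
  is_series (fun n => c n * z ^ n)%C l -> CPS c z = l.
Proof. apply Csum_unique. Qed.

Lemma nonneg_term_le_Series (a : nat -> R) (n : nat) :
  (forall k, 0 <= a k) -> ex_series a -> a n <= Series a.
Proof.
  intros Ha Hs; eapply Rle_trans; [|apply (sum_n_le_Series a n Ha Hs)].
  assert (Hn : forall N, 0 <= sum_n a N).
  { induction N as [|N IH]; [rewrite sum_O; apply Ha|].
    rewrite sum_Sn; unfold plus; simpl; specialize (Ha (S N)); lra. }
  destruct n as [|n]; [rewrite sum_O; apply Rle_refl|].
  rewrite sum_Sn; unfold plus; simpl; specialize (Hn n); lra.
Qed.

Definition CPS_cons (x : C) (c : nat -> C) (n : nat) : C :=
  match n with O => x | S m => c m end.

Lemma is_series_CPS_cons (x : C) (c : nat -> C) (z : C) :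
  disk_summable c -> in_disk z ->
  is_series (fun n => CPS_cons x c n * z ^ n)%C (x + z * CPS c z)%C.
Proof.
  intros Hc Hz.
  assert (H := is_series_C_scal z _ _ (CPS_correct c z Hc Hz)).
  assert (E : (x + z * CPS c z)%C = (CPS_cons x c O * z ^ 0 + z * CPS c z)%C)
    by (cbn [CPS_cons Cpow]; ring).
  rewrite E; apply (is_series_C_shift (fun n => CPS_cons x c n * z ^ n)%C).
  eapply is_series_C_ext; [|exact H].
  intros n; cbn [CPS_cons Cpow]; ring.
Qed.

Lemma disk_summable_cons (x : C) (c : nat -> C) :
  disk_summable c -> disk_summable (CPS_cons x c).
Proof.
  intros Hc; apply disk_summable_of_ex_series; intros z Hz.
  eexists; now apply is_series_CPS_cons.
Qed.

Lemma is_series_CPS_linear (c d : nat -> C) (e z : C) :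
  disk_summable c -> disk_summable d -> in_disk z ->
  is_series (fun n => (c n + e * d n) * z ^ n)%C (CPS c z + e * CPS d z)%C.
Proof.
  intros Hc Hd Hz.
  eapply is_series_C_ext;
    [|exact (is_series_C_plus _ _ _ _ (CPS_correct c z Hc Hz)
               (is_series_C_scal e _ _ (CPS_correct d z Hd Hz)))].
  intros n; cbv beta; ring.
Qed.

(** The condition on F = h + e g in terms of its coefficients. It is non-strict to match the
    nonnegativity of Re p in the two classical bounds. *)
Definition convex_bound (M : R) (c : nat -> C) : Prop :=
  disk_summable c /\
  forall z, in_disk z -> - M <= Re (z * CPS (CPS_derive (CPS_derive c)) z)%C.

Lemma convex_bound_caratheodory (M : R) (c : nat -> C) :
  convex_bound M c ->
  let p := CPS_cons M (CPS_derive (CPS_derive c)) in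
  disk_summable p /\
  (forall z, in_disk z ->
     Re (CPS p z) = M + Re (z * CPS (CPS_derive (CPS_derive c)) z)%C) /\
  (forall z, in_disk z -> 0 <= Re (CPS p z)).
Proof.
  intros [Hc HM] p.
  assert (Hcc := disk_summable_derive _ (disk_summable_derive _ Hc)).
  assert (HE : forall z, in_disk z ->
     Re (CPS p z) = M + Re (z * CPS (CPS_derive (CPS_derive c)) z)%C).
  { intros z Hz; unfold p.
    now rewrite (CPS_unique _ _ _ (is_series_CPS_cons M _ z Hcc Hz)), re_plus, re_RtoC. }
  split; [now apply disk_summable_cons|split; [exact HE|]].
  intros z Hz; rewrite HE by exact Hz; specialize (HM z Hz); lra.
Qed.

(** The coefficient of z^(n+1) in M + z F'' is (n + 1)(n + 2) c_(n+2), while the constant one is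
    M. *)
Lemma convex_bound_coefficient (M : R) (c : nat -> C) (n : nat) :
  convex_bound M c ->
  INR (S n) * INR (S (S n)) * Cmod (c (S (S n))) <= 2 * M.
Proof.
  intros H; destruct (convex_bound_caratheodory M c H) as [Hs [_ Hp]].
  assert (Hc := caratheodory_coefficient _ (S n) Hs Hp ltac:(discriminate)).
  simpl CPS_cons in Hc; rewrite re_RtoC in Hc.
  unfold CPS_derive in Hc; rewrite !Cmod_mult, !Cmod_R, !Rabs_pos_eq in Hc by apply pos_INR.
  lra.
Qed.

Lemma convex_bound_lower (M : R) (c : nat -> C) (z : C) :
  convex_bound M c -> in_disk z ->
  - 2 * M * Cmod z / (1 + Cmod z) <= Re (z * CPS (CPS_derive (CPS_derive c)) z)%C.
Proof.
  intros H Hz; destruct (convex_bound_caratheodory M c H) as [Hs [HE Hp]].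
  assert (Hh := harnack _ z Hs Hp Hz).
  rewrite (HE z Hz) in Hh; simpl CPS_cons in Hh; rewrite re_RtoC in Hh.
  assert (H0 := Cmod_ge_0 z).
  replace (- 2 * M * Cmod z / (1 + Cmod z))
    with ((1 - Cmod z) / (1 + Cmod z) * M - M) by (field; lra).
  lra.
Qed.

(** * Growth along a ray *)

Lemma nonneg_of_derive_nonneg (f f' : R -> R) :
  (forall t, 0 <= t < 1 -> is_derive f t (f' t)) -> f 0 = 0 ->
  (forall t, 0 < t < 1 -> 0 <= f' t) -> forall t, 0 <= t < 1 -> 0 <= f t.
Proof.
  intros Hd H0 Hp t Ht.
  destruct (Req_dec t 0) as [->|Hne]; [lra|].
  destruct (MVT_cor2 f f' 0 t) as [x [Hx Hx']]; [lra| |].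
  - intros x Hx; apply is_derive_Reals, Hd; lra.
  - specialize (Hp x ltac:(lra)).
    assert (0 <= f' x * (t - 0)) by (apply Rmult_le_pos; lra). lra.
Qed.

(** The sign of f'' is required only for t > 0, because in use it comes from a relation for t f''(t)
    after division by t. *)
Lemma nonneg_of_derive2_nonneg (f f' f'' : R -> R) :
  (forall t, 0 <= t < 1 -> is_derive f t (f' t)) ->
  (forall t, 0 <= t < 1 -> is_derive f' t (f'' t)) ->
  f 0 = 0 -> f' 0 = 0 -> (forall t, 0 < t < 1 -> 0 <= f'' t) ->
  forall t, 0 <= t < 1 -> 0 <= f t.
Proof.
  intros H1 H2 H0 H0' Hp.
  apply (nonneg_of_derive_nonneg f f' H1 H0); intros t Ht.
  apply (nonneg_of_derive_nonneg f' f'' H2 H0' Hp); lra.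
Qed.

(* The solution of [L'' = -2M / (1 + t)], [L 0 = 0], [L' 0 = 1]. *)
Definition growth_bound (M t : R) : R := t - 2 * M * ((1 + t) * ln (1 + t) - t).

Lemma growth_bound_1 (M : R) : growth_bound M 1 = 1 - 2 * M * (2 * ln 2 - 1).
Proof. unfold growth_bound; replace (1 + 1) with 2 by ring; ring. Qed.

Lemma continuity_pt_growth_bound (M : R) : continuity_pt (growth_bound M) 1.
Proof.
  apply derivable_continuous_pt, ex_derive_Reals_0.
  unfold growth_bound; auto_derive; lra.
Qed.

Lemma is_derive_growth_bound (M t : R) :
  0 <= t -> is_derive (growth_bound M) t (1 - 2 * M * ln (1 + t)).
Proof.
  intros Ht; unfold growth_bound; auto_derive; [lra|field; lra].
Qed.

Lemma is_derive_growth_bound' (M t : R) :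
  0 <= t -> is_derive (fun t => 1 - 2 * M * ln (1 + t)) t (- 2 * M / (1 + t)).
Proof. intros Ht; auto_derive; [lra|field; lra]. Qed.

Lemma in_disk_ray (t : R) (u : C) : Cmod u = 1 -> 0 <= t < 1 -> in_disk (t * u)%C.
Proof.
  intros Hu Ht; unfold in_disk; rewrite Cmod_mult, Hu, Cmod_R, Rabs_pos_eq; lra.
Qed.

(** On a ray the real part is a real power series, so real differentiation applies. Its derivative
    is stated for the [PSeries] and not for [G]: the two are identified only on [0,1), while the
    derivative at 0 is two-sided. *)
Lemma ray_derivatives (c : nat -> C) (u : C) :
  disk_summable c -> Cmod u = 1 -> c O = 0%C -> c 1%nat = 1%C ->
  exists G' G'' : R -> R,
    let G := fun t : R => Re (Cconj u * CPS c (t * u))%C in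
    G 0 = 0 /\ G' 0 = 1 /\
    forall t, 0 <= t < 1 ->
      is_derive (PSeries (fun n => Re (Cconj u * c n * u ^ n)%C)) t (G' t) /\
      PSeries (fun n => Re (Cconj u * c n * u ^ n)%C) t = G t /\
      is_derive G' t (G'' t) /\
      t * G'' t = Re (t * u * CPS (CPS_derive (CPS_derive c)) (t * u))%C.
Proof.
  intros Hc Hu H0 H1.
  set (d := fun n => Re (Cconj u * c n * u ^ n)%C).
  assert (Hd : forall x, Rabs x < 1 -> Rbar_lt (Rabs x) (CV_radius d)).
  { intros x Hx; apply CV_radius_ge_1; [|exact Hx].
    intros y Hy; exists (Series (fun n => Cmod (c n) * y ^ n)); intros n.
    eapply Rle_trans; [|apply (nonneg_term_le_Series (fun n => Cmod (c n) * y ^ n) n)].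
    - rewrite Rabs_mult, (Rabs_pos_eq (y ^ n)) by apply pow_le, Hy.
      apply Rmult_le_compat_r; [apply pow_le, Hy|].
      unfold d; eapply Rle_trans; [apply re_le_Cmod|].
      rewrite !Cmod_mult, Cmod_conj, Cmod_pow, Hu, pow1; lra.
    - intros k; apply Rmult_le_pos; [apply Cmod_ge_0|apply pow_le, Hy].
    - now apply ex_series_disk. }
  assert (HG : forall t, 0 <= t < 1 ->
    PSeries d t = Re (Cconj u * CPS c (t * u))%C).
  { intros t Ht; apply is_series_unique.
    eapply is_series_ext; [|exact (is_series_Re _ _ (is_series_C_scal (Cconj u) _ _
      (CPS_correct c _ Hc (in_disk_ray t u Hu Ht))))].
    intros n; cbv beta; unfold d.
    replace (Cconj u * (c n * (t * u) ^ n))%C with (Cconj u * c n * u ^ n * RtoC (t ^ n))%C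
      by (rewrite Cpow_mult_l, RtoC_pow; ring).
    apply re_scal_r. }
  exists (PSeries (PS_derive d)), (PSeries (PS_derive (PS_derive d))).
  split; [|split].
  - cbv beta; rewrite <- HG by lra; rewrite PSeries_0; unfold d; rewrite H0.
    replace (Cconj u * 0 * u ^ 0)%C with (RtoC 0) by ring; apply re_RtoC.
  - rewrite PSeries_0; unfold PS_derive, d; rewrite H1.
    replace (Cconj u * 1 * u ^ 1)%C with (u * Cconj u)%C by (simpl; ring).
    rewrite Cunit_conj by exact Hu; rewrite re_RtoC; simpl; ring.
  - intros t Ht.
    assert (HR : Rabs t < 1) by (rewrite Rabs_pos_eq; lra).
    split; [|split; [|split]].
    + now apply is_derive_PSeries, Hd.
    + now apply HG.
    + apply is_derive_PSeries; rewrite CV_radius_derive; now apply Hd.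
    + unfold PSeries; rewrite <- Series_scal_l; apply is_series_unique.
      assert (Hcc := disk_summable_derive _ (disk_summable_derive _ Hc)).
      eapply is_series_ext; [|exact (is_series_Re _ _ (is_series_C_scal (t * u)%C _ _
        (CPS_correct _ _ Hcc (in_disk_ray t u Hu Ht))))].
      intros n; unfold PS_derive, d, CPS_derive.
      (* The product of u and its conjugate, equal to 1, is inserted so that both sides show the
         same complex factor. *)
      replace (t * u * (INR (S n) * (INR (S (S n)) * c (S (S n))) * (t * u) ^ n))%C
        with (RtoC (t * (INR (S n) * INR (S (S n)) * t ^ n)) * 
              ((u * Cconj u) * u * c (S (S n)) * u ^ n))%C.
      * rewrite re_scal_l.
        replace (Cconj u * c (S (S n)) * u ^ S (S n))%C
          with ((u * Cconj u) * u * c (S (S n)) * u ^ n)%C by (cbn [Cpow]; ring).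
        match goal with |- @eq _ ?x ?y => change (@eq R x y) end; ring.
      * rewrite Cunit_conj by exact Hu.
        rewrite !RtoC_mult, RtoC_pow, Cpow_mult_l; ring.
Qed.

(** The real part and [growth_bound] have the same value and slope at 0, and the Harnack bound
    orders their second derivatives. *)
Lemma growth (M : R) (c : nat -> C) (u : C) (t : R) :
  convex_bound M c -> Cmod u = 1 -> c O = 0%C -> c 1%nat = 1%C -> 0 <= t < 1 ->
  growth_bound M t <= Re (Cconj u * CPS c (t * u))%C.
Proof.
  intros HM Hu H0 H1.
  destruct (ray_derivatives c u (proj1 HM) Hu H0 H1) as [G' [G'' [HG0 [HG1 HG]]]].
  set (G := PSeries (fun n => Re (Cconj u * c n * u ^ n)%C)) in *.
  assert (E0 : G 0 = 0) by (rewrite (proj1 (proj2 (HG 0 ltac:(lra)))); exact HG0).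
  intros Ht; rewrite <- (proj1 (proj2 (HG t Ht))).
  cut (0 <= G t - growth_bound M t); [lra|]; revert t Ht.
  apply (nonneg_of_derive2_nonneg _ (fun t => G' t - (1 - 2 * M * ln (1 + t)))
           (fun t => G'' t - - 2 * M / (1 + t))).
  - intros t Ht; apply (is_derive_minus (K := R_AbsRing) (V := R_NormedModule));
      [apply HG, Ht|apply is_derive_growth_bound, Ht].
  - intros t Ht; apply (is_derive_minus (K := R_AbsRing) (V := R_NormedModule));
      [apply HG, Ht|apply is_derive_growth_bound', Ht].
  - rewrite E0; unfold growth_bound; rewrite Rplus_0_r, ln_1; ring.
  - rewrite HG1, Rplus_0_r, ln_1; ring.
  - intros t Ht.
    assert (Hd := in_disk_ray t u Hu ltac:(lra)).
    destruct (HG t ltac:(lra)) as [_ [_ [_ HG2]]].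
    assert (H := convex_bound_lower M c _ HM Hd).
    rewrite <- HG2, Cmod_mult, Hu, Cmod_R, Rabs_pos_eq, Rmult_1_r in H by lra.
    apply (Rmult_le_reg_l t); [lra|].
    replace (t * (G'' t - - 2 * M / (1 + t)))
      with (t * G'' t - - 2 * M * t / (1 + t)) by (field; lra); lra.
Qed.

(** * The class in terms of power series *)

(* Overwrites the irrelevant entries of index 0 and 1. *)
Definition normalized (c1 : C) (a : nat -> C) (n : nat) : C :=
  match n with O => RtoC 0 | S O => c1 | _ => a n end.

Lemma is_series_normalized (c1 : C) (a : nat -> C) (z l : C) :
  is_series (fun n => (a (n + 2)%nat * z ^ (n + 2))%C) l ->
  is_series (fun n => normalized c1 a n * z ^ n)%C (c1 * z + l)%C.
Proof.
  intros H.
  assert (E : (c1 * z + l)%C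
    = (normalized c1 a 0 * z ^ 0 + (normalized c1 a 1 * z ^ 1 + l))%C)
    by (cbn [normalized Cpow]; ring).
  rewrite E.
  apply (is_series_C_shift (fun n => normalized c1 a n * z ^ n)%C).
  apply (is_series_C_shift (fun n => normalized c1 a (S n) * z ^ S n)%C).
  eapply is_series_C_ext; [|exact H].
  intros n; cbv beta; now replace (n + 2)%nat with (S (S n)) by lia.
Qed.

Lemma has_coefficients_CPS (h g : C -> C) (a b : nat -> C) :
  has_coefficients h g a b ->
  disk_summable (normalized 1 a) /\ disk_summable (normalized 0 b) /\
  forall z, in_disk z ->
    h z = CPS (normalized 1 a) z /\ g z = CPS (normalized 0 b) z.
Proof.
  intros H.
  assert (Hh : forall z, in_disk z ->
    is_series (fun n => normalized 1 a n * z ^ n)%C (h z)).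
  { intros z Hz; assert (E : h z = (1 * z + (h z - z))%C) by ring.
    rewrite E; apply is_series_normalized; exact (proj1 (H z Hz)). }
  assert (Hg : forall z, in_disk z ->
    is_series (fun n => normalized 0 b n * z ^ n)%C (g z)).
  { intros z Hz; assert (E : g z = (0 * z + g z)%C) by ring.
    rewrite E; apply is_series_normalized; exact (proj2 (H z Hz)). }
  split; [|split].
  - apply disk_summable_of_ex_series; intros z Hz; eexists; now apply Hh.
  - apply disk_summable_of_ex_series; intros z Hz; eexists; now apply Hg.
  - intros z Hz; split; symmetry; apply CPS_unique; auto.
Qed.

(** The term |z g''| in the definition of the class absorbs Re (e z g'') for every unimodular e at
    once. *)
Lemma PH0_convex_bound (M : R) (h g : C -> C) (a b : nat -> C) (e : C) :
  in_PH0 M h g -> has_coefficients h g a b -> Cmod e = 1 ->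
  convex_bound M (fun n => normalized 1 a n + e * normalized 0 b n)%C.
Proof.
  intros [_ HM] Hab He.
  destruct (has_coefficients_CPS h g a b Hab) as [Ha [Hb Hhg]].
  split.
  - apply disk_summable_of_ex_series; intros z Hz.
    eexists; now apply is_series_CPS_linear.
  - intros z Hz.
    assert (Ha' := disk_summable_derive _ (disk_summable_derive _ Ha)).
    assert (Hb' := disk_summable_derive _ (disk_summable_derive _ Hb)).
    assert (E : CPS (CPS_derive (CPS_derive
        (fun n => normalized 1 a n + e * normalized 0 b n)%C)) z
      = (C_derive (C_derive h) z + e * C_derive (C_derive g) z)%C).
    { rewrite (C_derive2_CPS _ h z Ha (fun w Hw => proj1 (Hhg w Hw)) Hz).
      rewrite (C_derive2_CPS _ g z Hb (fun w Hw => proj2 (Hhg w Hw)) Hz).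
      rewrite <- (CPS_unique _ _ _ (is_series_CPS_linear _ _ e z Ha' Hb' Hz)).
      apply Csum_ext; intros n; unfold CPS_derive; ring. }
    rewrite E; specialize (HM z Hz).
    replace (z * (C_derive (C_derive h) z + e * C_derive (C_derive g) z))%C
      with (z * C_derive (C_derive h) z + e * (z * C_derive (C_derive g) z))%C by ring.
    rewrite re_plus.
    assert (H := re_le_Cmod (e * (z * C_derive (C_derive g) z))%C).
    rewrite Cmod_mult, He, Rmult_1_l in H; apply Rabs_le_between in H; lra.
Qed.

Lemma exists_aligning_unit (x y : C) :
  exists e, Cmod e = 1 /\ Cmod (x + e * y)%C = Cmod x + Cmod y.
Proof.
  destruct (unit_factor x) as [u [Hu Hx]], (unit_factor y) as [v [Hv Hy]].
  (* This rotates the direction of y onto that of x. *)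
  exists (u * Cconj v)%C; split.
  - rewrite Cmod_mult, Cmod_conj, Hu, Hv; ring.
  - assert (E : (x + u * Cconj v * y)%C = (RtoC (Cmod x + Cmod y) * u)%C).
    { rewrite Hx at 1; rewrite Hy at 1; rewrite RtoC_plus.
      transitivity (Cmod x * u + Cmod y * u * (v * Cconj v))%C; [ring|].
      rewrite Cunit_conj by exact Hv; ring. }
    rewrite E, Cmod_mult, Hu, Cmod_R, Rabs_pos_eq; [ring|].
    generalize (Cmod_ge_0 x) (Cmod_ge_0 y); lra.
Qed.

Lemma PH0_coefficient_bound (M : R) (h g : C -> C) (a b : nat -> C) (n : nat) :
  in_PH0 M h g -> has_coefficients h g a b ->
  Cmod (a (n + 2)%nat) + Cmod (b (n + 2)%nat)
  <= 2 * M * / (INR (n + 2) * (INR (n + 2) - 1)).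
Proof.
  intros HM Hab; replace (n + 2)%nat with (S (S n)) by lia.
  destruct (exists_aligning_unit (a (S (S n))) (b (S (S n)))) as [e [He Hsum]].
  assert (H := convex_bound_coefficient M _ n (PH0_convex_bound M h g a b e HM Hab He)).
  cbn [normalized] in H; rewrite Hsum in H.
  assert (Hn := pos_INR n); rewrite !S_INR in *.
  assert (Hd : 0 < (INR n + 1 + 1) * (INR n + 1 + 1 - 1)) by nra.
  apply Rmult_le_reg_r with ((INR n + 1 + 1) * (INR n + 1 + 1 - 1)); [exact Hd|].
  rewrite (Rmult_assoc (2 * M)), Rinv_l by lra.
  replace (INR n + 1 + 1 - 1) with (INR n + 1) by ring; lra.
Qed.

(* On the ray through [u], the real part of [conj u * f] is that of [conj u * (h + u^2 g)]. *)
Lemma PH0_growth (M : R) (h g : C -> C) (a b : nat -> C) (z : C) :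
  in_PH0 M h g -> has_coefficients h g a b -> in_disk z ->
  growth_bound M (Cmod z) <= Cmod (harmonic_map h g z - harmonic_map h g 0)%C.
Proof.
  intros HM Hab Hz.
  destruct (has_coefficients_CPS h g a b Hab) as [Ha [Hb Hhg]].
  destruct (unit_factor z) as [u [Hu Hzu]].
  assert (Huu : Cmod (u * u)%C = 1) by (rewrite Cmod_mult, Hu; ring).
  assert (H := growth M _ u (Cmod z) (PH0_convex_bound M h g a b _ HM Hab Huu) Hu).
  rewrite <- Hzu in H.
  rewrite (CPS_unique _ _ _ (is_series_CPS_linear _ _ (u * u)%C z Ha Hb Hz)) in H.
  rewrite <- (proj1 (Hhg z Hz)), <- (proj2 (Hhg z Hz)) in H.
  destruct HM as [[_ [_ [Hh0 [_ [Hg0 _]]]]] _].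
  assert (E0 : harmonic_map h g 0 = 0%C).
  { unfold harmonic_map; rewrite Hh0, Hg0, Cconj_RtoC; ring. }
  rewrite E0.
  eapply Rle_trans; [apply H; [cbn; ring|cbn; ring|split; [apply Cmod_ge_0|exact Hz]]|].
  replace (Re (Cconj u * (h z + u * u * g z))%C)
    with (Re (Cconj u * (harmonic_map h g z - 0))%C).
  - eapply Rle_trans; [apply Rle_abs|]; eapply Rle_trans; [apply re_le_Cmod|].
    rewrite Cmod_mult, Cmod_conj, Hu; lra.
  - unfold harmonic_map.
    replace (Cconj u * (h z + u * u * g z))%C
      with (Cconj u * h z + u * g z * (u * Cconj u))%C by ring.
    replace (Cconj u * (h z + Cconj (g z) - 0))%C
      with (Cconj u * h z + Cconj u * Cconj (g z))%C by ring.
    rewrite Cunit_conj by exact Hu; rewrite Cmult_1_r, !re_plus, <- Cmult_conj, re_conj.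
    reflexivity.
Qed.

(** * The distance to the boundary *)

Lemma dist_to_boundary_ge (f : C -> C) (L : R -> R) :
  continuity_pt L 1 ->
  (forall z, in_disk z -> L (Cmod z) <= Cmod (f z - f 0%C)%C) ->
  Rbar_le (Finite (L 1)) (dist_to_boundary f).
Proof.
  intros HL Hf; unfold dist_to_boundary.
  set (E := fun m : R => _).
  assert (Heps : forall eps, 0 < eps -> exists m, E m /\ L 1 - eps <= m).
  { intros eps He.
    destruct (HL eps He) as [d [Hd HLd]].
    (* By continuity, L stays above L 1 - eps on radii between s and 1. *)
    set (s := Rmax 0 (1 - d)).
    assert (Hs0 : 0 <= s) by apply Rmax_l.
    assert (Hs1 : 1 - d <= s) by apply Rmax_r.
    assert (Hs : s < 1) by (unfold s; apply Rmax_case; lra).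
    set (A := fun x : R => exists z : C, s < Cmod z < 1 /\ x = Cmod (f z - f 0%C)%C).
    assert (HA := Glb_Rbar_correct A).
    assert (Hlow : Rbar_le (Finite (L 1 - eps)) (Glb_Rbar A)).
    { apply HA; intros x [z [Hz ->]].
      assert (H1 : Rabs (L (Cmod z) - L 1) < eps).
      { apply HLd; split; [split; [exact I|lra]|].
        simpl; unfold R_dist; rewrite Rabs_left; lra. }
      apply Rabs_def2 in H1; simpl.
      specialize (Hf z (proj2 Hz)); lra. }
    (* A point of the annulus: its infimum is thus not +infinity, and is a real number as
       [dist_to_boundary] demands. *)
    set (t := (1 + s) / 2).
    assert (Hup : Rbar_le (Glb_Rbar A) (Finite (Cmod (f t - f 0%C)%C))).
    { apply HA; exists (RtoC t); split; [|reflexivity].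
      rewrite Cmod_R, Rabs_pos_eq; unfold t; lra. }
    destruct (Glb_Rbar A) as [m| |] eqn:Em; try (now simpl in Hlow, Hup).
    exists m; split; [|exact Hlow].
    exists s; split; [lra|now rewrite <- Em]. }
  assert (HE := Lub_Rbar_correct E).
  destruct (Lub_Rbar E) as [l| |]; simpl; [|exact I|].
  - apply Rnot_lt_le; intros Hlt.
    destruct (Heps ((L 1 - l) / 2)) as [m [Hm Hm']]; [lra|].
    assert (H := proj1 HE m Hm); simpl in H; lra.
  - destruct (Heps 1) as [m [Hm _]]; [lra|].
    exact (proj1 HE m Hm).
Qed.

(** Every annulus contains the real points t close to 1, so each infimum is at most L t and, in the
    limit, at most L 1. Signs are reversed because [le_at_1] gives upper bounds. *)
Lemma dist_to_boundary_le (f : C -> C) (L : R -> R) :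
  continuity_pt L 1 ->
  (forall t, 0 < t < 1 -> Cmod (f t - f 0%C)%C <= L t) ->
  Rbar_le (dist_to_boundary f) (Finite (L 1)).
Proof.
  intros HL Hf; apply (Lub_Rbar_correct _); intros m [s [Hs Hm]].
  simpl; apply Ropp_le_cancel.
  apply (le_at_1 (fun t => - L t) s); [lra|now apply continuity_pt_opp|].
  intros t Ht; apply Ropp_le_contravar.
  eapply Rle_trans; [|apply Hf; lra].
  change (Rbar_le m (Cmod (f t - f 0%C)%C)); rewrite Hm.
  apply (Glb_Rbar_correct _); exists (RtoC t); split; [|reflexivity].
  rewrite Cmod_R, Rabs_pos_eq; lra.
Qed.
(** * The extremal function *)

(** From -2M / (1 + z) = -2M sum (-1)^n z^n by integrating twice; the shift by 2 preserves the sign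
    (-1)^n. At n = 0 and 1 the quotient is a division by zero, and [normalized] replaces these
    entries. *)
Definition extremal_coefficient (M : R) (n : nat) : C :=
  RtoC (- 2 * M * (-1) ^ n / (INR n * (INR n - 1))).

Definition extremal (M : R) : C -> C := CPS (normalized 1 (extremal_coefficient M)).

Lemma Cmod_extremal_coefficient (M : R) (n : nat) :
  0 < M ->
  Cmod (extremal_coefficient M (n + 2)%nat)
  = 2 * M * / (INR (n + 2) * (INR (n + 2) - 1)).
Proof.
  intros HM; unfold extremal_coefficient; rewrite Cmod_R.
  assert (Hn := pos_INR n); replace (INR (n + 2)) with (INR n + 2)
    by (rewrite plus_INR; simpl; ring).
  unfold Rdiv; rewrite !Rabs_mult, pow_1_abs, Rabs_inv, (Rabs_left (-2)) by lra.
  rewrite !Rabs_pos_eq by nra; ring.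
Qed.

Lemma extremal_summable (M : R) :
  0 < M -> disk_summable (normalized 1 (extremal_coefficient M)).
Proof.
  intros HM; apply disk_summable_bounded; intros y Hy; exists (1 + 2 * M); intros n.
  assert (Hy1 : 0 <= y ^ n <= 1).
  { split; [apply pow_le, Hy|]; rewrite <- (pow1 n); apply pow_incr; lra. }
  assert (Hc : 0 <= Cmod (normalized 1 (extremal_coefficient M) n) <= 1 + 2 * M).
  { split; [apply Cmod_ge_0|]; destruct n as [|[|n]]; cbn [normalized].
    - rewrite Cmod_0; lra.
    - rewrite Cmod_1; lra.
    - replace (S (S n)) with (n + 2)%nat by lia; rewrite Cmod_extremal_coefficient by exact HM.
      assert (Hn := pos_INR n); rewrite plus_INR; simpl (INR 2).
      assert (H : / ((INR n + 2) * (INR n + 2 - 1)) <= 1).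
      { rewrite <- Rinv_1 at 2; apply Rinv_le_contravar; nra. }
      apply (Rmult_le_compat_l (2 * M)) in H; [|lra].
      replace (1 + 1) with 2 by ring; lra. }
  nra.
Qed.

Lemma extremal_has_coefficients (M : R) :
  0 < M ->
  has_coefficients (extremal M) (fun _ => RtoC 0) (extremal_coefficient M) (fun _ => RtoC 0).
Proof.
  intros HM z Hz; split.
  - assert (H := CPS_correct _ z (extremal_summable M HM) Hz); fold (extremal M) in H.
    set (c := normalized 1 (extremal_coefficient M)) in *.
    assert (E : extremal M z = (c O * z ^ 0 + (c 1%nat * z ^ 1 + (extremal M z - z)))%C)
      by (unfold c; cbn [normalized Cpow]; ring).
    rewrite E in H.
    apply (is_series_C_shift (fun n => c n * z ^ n)%C) in H.
    apply (is_series_C_shift (fun n => c (S n) * z ^ S n)%C) in H.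
    eapply is_series_C_ext; [|exact H].
    intros n; cbv beta; now replace (n + 2)%nat with (S (S n)) by lia.
  - eapply is_series_C_ext; [|exact (is_series_single 0 (RtoC 0))].
    intros n; cbv beta; destruct (n =? 0)%nat; ring.
Qed.

Lemma extremal_derive2 (M : R) (z : C) :
  in_disk z ->
  CPS (CPS_derive (CPS_derive (normalized 1 (extremal_coefficient M)))) z
  = (RtoC (- 2 * M) * / (1 + z))%C.
Proof.
  intros Hz; apply CPS_unique.
  assert (Hz' : Cmod (- z) < 1) by (rewrite Cmod_opp; exact Hz).
  assert (H := is_series_C_scal (RtoC (- 2 * M)) _ _ (is_series_Cgeom _ Hz')).
  replace (1 - - z)%C with (1 + z)%C in H by ring.
  eapply is_series_C_ext; [|exact H].
  intros n; unfold CPS_derive; cbn [normalized]; unfold extremal_coefficient.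
  replace (- z)%C with (RtoC (-1) * z)%C
    by (replace (-1) with (- (1)) by ring; rewrite RtoC_opp; ring).
  rewrite Cpow_mult_l, <- RtoC_pow.
  rewrite !Cmult_assoc, <- !RtoC_mult; f_equal; f_equal.
  assert (Hn := pos_INR n); rewrite !S_INR; simpl pow; field; lra.
Qed.

Lemma extremal_PH0 (M : R) : 0 < M -> in_PH0 M (extremal M) (fun _ => RtoC 0).
Proof.
  intros HM.
  assert (Hs := extremal_summable M HM).
  assert (D0 : forall z, is_derive (K := C_AbsRing) (V := C_NormedModule)
                           (fun _ => RtoC 0) z (RtoC 0)).
  { intros z; exact (is_derive_const (K := C_AbsRing) (V := C_NormedModule) (RtoC 0) z). }
  assert (D1 : forall z, C_derive (fun _ => RtoC 0) z = RtoC 0).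
  { intros z; now apply is_C_derive_unique. }
  assert (Z : in_disk 0%C) by (unfold in_disk; rewrite Cmod_0; lra).
  assert (C0 : forall c : nat -> C, disk_summable c -> CPS c 0 = c O).
  { intros c Hc; apply CPS_unique.
    eapply is_series_C_ext; [|exact (is_series_single 0 (c O))].
    intros n; destruct n; cbn [Nat.eqb Cpow]; ring. }
  split.
  - split; [|split; [|split; [|split; [|split]]]].
    + intros z Hz; exact (proj1 (C_derive_CPS _ (extremal M) Hs (fun w _ => eq_refl) z Hz)).
    + intros z _; eexists; apply D0.
    + unfold extremal; now rewrite C0.
    + rewrite (proj2 (C_derive_CPS _ (extremal M) Hs (fun w _ => eq_refl) _ Z)).
      rewrite C0 by now apply disk_summable_derive.
      unfold CPS_derive; cbn [normalized INR]; ring.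
    + reflexivity.
    + apply D1.
  - intros z Hz.
    rewrite (C_derive2_CPS _ (extremal M) z Hs (fun w _ => eq_refl) Hz).
    rewrite extremal_derive2 by exact Hz.
    replace (C_derive (C_derive (fun _ => RtoC 0)) z) with (RtoC 0).
    2:{ symmetry; apply is_C_derive_unique.
        apply (is_derive_ext (fun _ => RtoC 0)); [intros t; now rewrite D1|apply D0]. }
    rewrite Cmult_0_r, Cmod_0.
    assert (Hz' : Cmod (- z) < 1) by (rewrite Cmod_opp; exact Hz).
    assert (Hm := Re_mobius _ Hz').
    assert (Hne : (1 + z)%C <> 0%C).
    { intros E; assert (z = (- (1))%C) as Ez by (replace z with (1 + z - 1)%C by ring;
        rewrite E; ring).
      unfold in_disk in Hz; rewrite Ez, Cmod_m1 in Hz; lra. }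
    (* Here z h'' = M (1 - z) / (1 + z) - M, and [Re_mobius] at -z makes the first summand's real
       part positive. *)
    replace (z * (RtoC (- 2 * M) * / (1 + z)))%C
      with (RtoC M * ((1 + - z) / (1 - - z)) + RtoC (- M))%C.
    2:{ rewrite RtoC_mult, !RtoC_opp; field.
        replace (1 - - z)%C with (1 + z)%C by ring; auto. }
    rewrite re_plus, re_scal_l, re_RtoC.
    assert (Hpos : 0 < (1 - Cmod (- z)) / (1 + Cmod (- z))).
    { generalize (Cmod_ge_0 (- z)); intros; apply Rdiv_lt_0_compat; lra. }
    assert (0 < M * Re ((1 + - z) / (1 - - z))%C) by (apply Rmult_lt_0_compat; lra).
    lra.
Qed.

(** The coefficients are real, so the values are too. The real part solves the same initial value
    problem as [growth_bound]; equality follows from applying the comparison lemma to the difference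
    and to its opposite. *)
Lemma extremal_on_ray (M t : R) :
  0 < M -> 0 <= t < 1 -> extremal M t = growth_bound M t.
Proof.
  intros HM Ht.
  assert (Hs := extremal_summable M HM).
  set (c := normalized 1 (extremal_coefficient M)) in *.
  destruct (ray_derivatives c 1 Hs Cmod_1 eq_refl eq_refl)
    as [G' [G'' [HG0 [HG1 HG]]]].
  set (G := PSeries _) in HG.
  assert (HIm : Im (extremal M t) = 0).
  { unfold extremal; fold c.
    rewrite <- (is_series_unique _ _ (is_series_Im _ _ (CPS_correct c t Hs
       ltac:(unfold in_disk; rewrite Cmod_R, Rabs_pos_eq; lra)))).
    rewrite <- (is_series_unique _ _ (is_series_single_R 0 0)).
    apply Series_ext; intros n.
    replace (Im (c n * t ^ n)%C) with 0 by
      (rewrite <- RtoC_pow, im_scal_r; destruct n as [|[|n]]; simpl; ring).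
    now destruct (n =? 0)%nat. }
  assert (HGL : G t = growth_bound M t).
  { assert (E0 : G 0 = 0) by (rewrite (proj1 (proj2 (HG 0 ltac:(lra)))); exact HG0).
    assert (HG2 : forall t, 0 < t < 1 -> G'' t = - 2 * M / (1 + t)).
    { intros s Hs1; destruct (HG s ltac:(lra)) as [_ [_ [_ H]]].
      unfold c in H; rewrite extremal_derive2 in H
        by (unfold in_disk; rewrite Cmult_1_r, Cmod_R, Rabs_pos_eq; lra).
      apply (Rmult_eq_reg_l s); [|lra]; rewrite H, Cmult_1_r.
      rewrite <- RtoC_plus, <- RtoC_inv, <- !RtoC_mult, re_RtoC by lra.
      unfold Rdiv; ring. }
    assert (H1 : forall t, 0 <= t < 1 ->
      is_derive (fun t => G t - growth_bound M t) t (G' t - (1 - 2 * M * ln (1 + t)))).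
    { intros s Hs1; apply (is_derive_minus (K := R_AbsRing) (V := R_NormedModule));
        [apply HG, Hs1|apply is_derive_growth_bound, Hs1]. }
    assert (H2 : forall t, 0 <= t < 1 ->
      is_derive (fun t => G' t - (1 - 2 * M * ln (1 + t))) t (G'' t - - 2 * M / (1 + t))).
    { intros s Hs1; apply (is_derive_minus (K := R_AbsRing) (V := R_NormedModule));
        [apply HG, Hs1|apply is_derive_growth_bound', Hs1]. }
    assert (E : 0 <= G t - growth_bound M t).
    { refine (nonneg_of_derive2_nonneg _ _ _ H1 H2 _ _ _ t Ht).
      - rewrite E0; unfold growth_bound; rewrite Rplus_0_r, ln_1; ring.
      - rewrite HG1, Rplus_0_r, ln_1; ring.
      - intros s Hs1; rewrite HG2 by exact Hs1; lra. }
    assert (E' : 0 <= - (G t - growth_bound M t)).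
    { refine (nonneg_of_derive2_nonneg (fun t => - (G t - growth_bound M t))
        (fun t => - (G' t - (1 - 2 * M * ln (1 + t))))
        (fun t => - (G'' t - - 2 * M / (1 + t))) _ _ _ _ _ t Ht).
      - intros s Hs1; apply (is_derive_opp (K := R_AbsRing) (V := R_NormedModule)), H1, Hs1.
      - intros s Hs1; apply (is_derive_opp (K := R_AbsRing) (V := R_NormedModule)), H2, Hs1.
      - rewrite E0; unfold growth_bound; rewrite Rplus_0_r, ln_1; ring.
      - rewrite HG1, Rplus_0_r, ln_1; ring.
      - intros s Hs1; rewrite HG2 by exact Hs1; lra. }
    lra. }
  apply injective_projections; [|exact HIm].
  rewrite <- HGL, (proj1 (proj2 (HG t Ht))).
  rewrite Cconj_RtoC, Cmult_1_l, Cmult_1_r; reflexivity.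
Qed.

(** On the positive radius the modulus is |[growth_bound M t]|, which tends to |[growth_bound M 1]|;
    the sign hypothesis removes the absolute value at 1. *)
Lemma dist_to_boundary_extremal (M : R) :
  0 < M -> 0 <= growth_bound M 1 ->
  Rbar_le (dist_to_boundary (harmonic_map (extremal M) (fun _ => RtoC 0)))
          (Finite (growth_bound M 1)).
Proof.
  intros HM H1.
  rewrite <- (Rabs_pos_eq _ H1).
  apply (dist_to_boundary_le _ (fun t => Rabs (growth_bound M t))).
  - apply (continuity_pt_comp (growth_bound M) Rabs);
      [apply continuity_pt_growth_bound|apply Rcontinuity_abs].
  - intros t Ht; unfold harmonic_map.
    rewrite !extremal_on_ray, Cconj_RtoC by lra.
    unfold growth_bound at 2; rewrite Rplus_0_r, ln_1.
    replace (RtoC (0 - 2 * M * (1 * 0 - 0))) with (RtoC 0) by (f_equal; ring).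
    replace (growth_bound M t + 0 - (0 + 0))%C with (RtoC (growth_bound M t)) by ring.
    rewrite Cmod_R; apply Rle_refl.
Qed.
(** * The radius *)

Lemma ex_series_phi (phi : nat -> R -> R) (r : R) :
  series_cv_locally_uniformly phi -> 0 <= r < 1 -> ex_series (fun n => phi n r).
Proof.
  intros Hphi Hr; destruct (Hphi r Hr) as [d Hd].
  destruct (CVU_CVS_dom _ _ Hd r) as [l Hl].
  - split; [exact Hr|]; rewrite Rminus_diag, Rabs_R0; apply cond_pos.
  - exists l; exact Hl.
Qed.

Lemma weight_gt_1 (n : nat) : 1 <= INR (n + 2) * (INR (n + 2) - 1).
Proof. assert (H := pos_INR n); rewrite plus_INR; simpl; nra. Qed.

Definition weighted_term (phi : nat -> R -> R) (r : R) (n : nat) : R :=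
  phi (n + 2)%nat r / (INR (n + 2) * (INR (n + 2) - 1)).

Lemma weighted_term_mono (phi : nat -> R -> R) (r s : R) (n : nat) :
  phi (n + 2)%nat r <= phi (n + 2)%nat s -> weighted_term phi r n <= weighted_term phi s n.
Proof.
  intros H; apply Rmult_le_compat_r; [|exact H].
  generalize (weight_gt_1 n); intros; apply Rlt_le, Rinv_0_lt_compat; lra.
Qed.

Lemma weighted_term_nonneg (phi : nat -> R -> R) (r : R) (n : nat) :
  0 <= phi (n + 2)%nat r -> 0 <= weighted_term phi r n.
Proof. intros H; apply Rdiv_le_0_compat; [exact H|generalize (weight_gt_1 n); lra]. Qed.

(** Each weight 1 / (n (n - 1)) is at most 1, so the series of the [phi n] dominates. *)
Lemma ex_series_weighted (phi : nat -> R -> R) (r : R) :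
  (forall (n : nat) (r : R), 0 <= r < 1 -> 0 <= phi n r) ->
  series_cv_locally_uniformly phi -> 0 <= r < 1 -> ex_series (weighted_term phi r).
Proof.
  intros Hpos Hphi Hr.
  apply (ex_series_le (V := R_CompleteNormedModule) _ (fun n => phi (n + 2)%nat r)).
  - intros n; change (Rabs (weighted_term phi r n) <= phi (n + 2)%nat r).
    assert (Hn := Hpos (n + 2)%nat r Hr).
    rewrite Rabs_pos_eq by now apply weighted_term_nonneg.
    unfold weighted_term, Rdiv; rewrite <- (Rmult_1_r (phi (n + 2)%nat r)) at 2.
    apply Rmult_le_compat_l; [exact Hn|].
    assert (Hi := Rinv_le_contravar 1 _ Rlt_0_1 (weight_gt_1 n)).
    now rewrite Rinv_1 in Hi.
  - apply (ex_series_ext (fun n => phi (2 + n)%nat r));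
      [intros n; f_equal; lia|].
    apply (ex_series_incr_n (fun n => phi n r) 2); now apply ex_series_phi.
Qed.

Lemma weighted_sum_mono (phi : nat -> R -> R) (r s : R) :
  (forall (n : nat) (r : R), 0 <= r < 1 -> 0 <= phi n r) ->
  (forall n : nat, nondecreasing_on_01 (phi n)) ->
  series_cv_locally_uniformly phi -> 0 <= r <= s -> s < 1 ->
  weighted_sum phi r <= weighted_sum phi s.
Proof.
  intros Hpos Hmono Hphi Hr Hs.
  apply (Series_le (weighted_term phi r) (weighted_term phi s)).
  - intros n; split; [apply weighted_term_nonneg, Hpos; lra|].
    apply weighted_term_mono, Hmono; lra.
  - apply ex_series_weighted; auto; lra.
Qed.

Lemma radius_fun_mono (M : R) (phi : nat -> R -> R) (r s : R) :
  0 < M -> (forall (n : nat) (r : R), 0 <= r < 1 -> 0 <= phi n r) ->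
  (forall n : nat, nondecreasing_on_01 (phi n)) ->
  series_cv_locally_uniformly phi -> 0 <= r <= s -> s < 1 ->
  radius_fun M phi r <= radius_fun M phi s.
Proof.
  intros HM Hpos Hmono Hphi Hr Hs; unfold radius_fun.
  assert (H1 := weighted_sum_mono phi r s Hpos Hmono Hphi Hr Hs).
  assert (H2 : r * phi 0%nat r <= s * phi 0%nat s).
  { apply Rmult_le_compat; [lra|apply Hpos; lra|lra|apply Hmono; lra]. }
  apply (Rmult_le_compat_l (2 * M)) in H1; lra.
Qed.

(** Strictness comes either from r [phi 0](r), or from one term of the weighted sum: all increments
    of terms are nonnegative, so the increment of the sum is at least that of this term. *)
Lemma radius_fun_strict_mono (M : R) (phi : nat -> R -> R) (r s : R) :
  0 < M -> (forall (n : nat) (r : R), 0 <= r < 1 -> 0 <= phi n r) ->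
  (forall n : nat, nondecreasing_on_01 (phi n)) ->
  series_cv_locally_uniformly phi ->
  (0 < phi 0%nat 0 \/ exists n : nat, n <> 1%nat /\ strictly_increasing_on_01 (phi n)) ->
  0 < r < s -> s < 1 -> radius_fun M phi r < radius_fun M phi s.
Proof.
  intros HM Hpos Hmono Hphi Hst Hr Hs; unfold radius_fun.
  assert (H1 := weighted_sum_mono phi r s Hpos Hmono Hphi ltac:(lra) Hs).
  assert (Hp0 := Hpos 0%nat r ltac:(lra)).
  assert (Hp1 := Hmono 0%nat r s ltac:(lra) ltac:(lra) Hs).
  destruct Hst as [H0|[[|[|n]] [Hn Hinc]]].
  - assert (H2 := Hmono 0%nat 0 r ltac:(lra) ltac:(lra) ltac:(lra)); nra.
  - assert (H2 := Hinc r s ltac:(lra) ltac:(lra) Hs); nra.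
  - now elim Hn.
  - assert (H2 := Hinc r s ltac:(lra) ltac:(lra) Hs).
    replace (S (S n)) with (n + 2)%nat in H2 by lia.
    assert (Hd : forall k, 0 <= weighted_term phi s k - weighted_term phi r k).
    { intros k; cut (weighted_term phi r k <= weighted_term phi s k); [lra|].
      apply weighted_term_mono, Hmono; lra. }
    assert (Er := ex_series_weighted phi r Hpos Hphi ltac:(lra)).
    assert (Es := ex_series_weighted phi s Hpos Hphi ltac:(lra)).
    assert (H := nonneg_term_le_Series (fun k => weighted_term phi s k - weighted_term phi r k)
                   n Hd (ex_series_minus _ _ Es Er)).
    rewrite Series_minus in H by assumption.
    change (weighted_term phi s n - weighted_term phi r n
            <= weighted_sum phi s - weighted_sum phi r) in H.
    assert (H3 : weighted_term phi r n < weighted_term phi s n).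
    { apply Rmult_lt_compat_r; [|exact H2].
      generalize (weight_gt_1 n); intros; apply Rinv_0_lt_compat; lra. }
    nra.
Qed.

(** The intermediate value theorem is applied on [0, r] with two-sided continuity at the endpoints,
    whereas u is only right continuous at 0; [Rmax y 0] extends it by a constant to the left. *)
Lemma continuity_pt_extend_left (u : R -> R) (x : R) :
  filterlim u (at_right 0) (locally (u 0)) ->
  (forall r, 0 < r < 1 -> ex_derive u r) -> x < 1 ->
  continuity_pt (fun y => u (Rmax y 0)) x.
Proof.
  intros H0 Hd Hx.
  destruct (Rtotal_order x 0) as [Hlt|[->|Hgt]].
  - apply (continuity_pt_ext_loc (fun _ => u 0)); [|now apply continuity_pt_const].
    exists (mkposreal (- x) ltac:(lra)); intros y Hy; apply Rabs_def2 in Hy.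
    unfold minus, plus, opp in Hy; simpl in Hy; rewrite Rmax_right; [reflexivity|lra].
  - apply continuity_pt_filterlim, filterlim_locally; intros eps.
    rewrite Rmax_right by lra.
    destruct (proj1 (filterlim_locally _ _) H0 eps) as [d Hdd].
    exists d; intros y Hy.
    destruct (Rle_or_lt y 0) as [Hy0|Hy0].
    + rewrite Rmax_right by exact Hy0; apply ball_center.
    + rewrite Rmax_left by lra; now apply Hdd.
  - apply (continuity_pt_ext_loc u).
    + exists (mkposreal x Hgt); intros y Hy; apply Rabs_def2 in Hy.
      unfold minus, plus, opp in Hy; simpl in Hy; rewrite Rmax_left; [reflexivity|lra].
    + apply derivable_continuous_pt, ex_derive_Reals_0, Hd; lra.
Qed.

(** Weierstrass test: by monotonicity the terms at a point r to the right of x dominate those at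
    every y < r, so the tail at r bounds all tails. *)
Lemma continuity_pt_weighted_sum (phi : nat -> R -> R) (x : R) :
  (forall (n : nat) (r : R), 0 <= r < 1 -> 0 <= phi n r) ->
  (forall n : nat, nondecreasing_on_01 (phi n)) ->
  (forall (n : nat) (r : R), 0 < r < 1 -> ex_derive (phi n) r) ->
  series_cv_locally_uniformly phi ->
  (forall n : nat, filterlim (phi n) (at_right 0) (locally (phi n 0))) ->
  x < 1 -> continuity_pt (fun y => weighted_sum phi (Rmax y 0)) x.
Proof.
  intros Hpos Hmono Hdiff Hphi H0 Hx.
  set (r := (Rmax x 0 + 1) / 2).
  assert (Hr : Rmax x 0 < r < 1) by (unfold r; apply Rmax_case; lra).
  assert (Hx0 := Rmax_l x 0); assert (Hr0 := Rmax_r x 0).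
  assert (Er := ex_series_weighted phi r Hpos Hphi ltac:(lra)).
  refine (CVU_cont_open (fun N y => sum_n (weighted_term phi (Rmax y 0)) N)
            (fun y => y < r) (open_lt r) _ _ x _); [| |lra].
  - intros eps.
    generalize (proj2 (is_lim_seq_spec _ (Finite (Series (weighted_term phi r))))
                  (Series_correct _ Er) eps).
    apply filter_imp; intros N HN y Hy.
    change (Rabs (sum_n (weighted_term phi r) N - Series (weighted_term phi r)) < eps) in HN.
    change (Rabs (sum_n (weighted_term phi (Rmax y 0)) N
                  - Series (weighted_term phi (Rmax y 0))) < eps).
    assert (Hy0 : 0 <= Rmax y 0 < r) by (split; [apply Rmax_r|apply Rmax_case; lra]).
    assert (Hnn : forall n, 0 <= weighted_term phi (Rmax y 0) n)
      by (intros n; apply weighted_term_nonneg, Hpos; lra).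
    assert (H1 := sum_n_lower (weighted_term phi (Rmax y 0)) (weighted_term phi r) N).
    assert (H2 := sum_n_le_Series _ N Hnn
              (ex_series_weighted phi (Rmax y 0) Hpos Hphi ltac:(lra))).
    apply Rabs_def2 in HN; apply Rabs_def1; [generalize (cond_pos eps); lra|].
    cut (Series (weighted_term phi (Rmax y 0))
         - (Series (weighted_term phi r) - sum_n (weighted_term phi r) N)
         <= sum_n (weighted_term phi (Rmax y 0)) N); [lra|].
    apply H1; [|exact Er].
    intros n; rewrite Rabs_pos_eq by apply Hnn.
    apply weighted_term_mono, Hmono; lra.
  - intros N y Hy; induction N as [|N IH].
    + apply (continuity_pt_ext (fun y => weighted_term phi (Rmax y 0) O));
        [intros t; now rewrite sum_O|].
      apply continuity_pt_mult; [|now apply continuity_pt_const].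
      apply continuity_pt_extend_left; auto; lra.
    + apply (continuity_pt_ext (fun y => sum_n (weighted_term phi (Rmax y 0)) N
                                 + weighted_term phi (Rmax y 0) (S N)));
        [intros t; now rewrite sum_Sn|].
      apply continuity_pt_plus; [exact IH|].
      apply continuity_pt_mult; [|now apply continuity_pt_const].
      apply continuity_pt_extend_left; auto; lra.
Qed.

Lemma radius_root_exists (M : R) (phi : nat -> R -> R) (r : R) :
  (forall (n : nat) (r : R), 0 <= r < 1 -> 0 <= phi n r) ->
  (forall n : nat, nondecreasing_on_01 (phi n)) ->
  (forall (n : nat) (r : R), 0 < r < 1 -> ex_derive (phi n) r) ->
  series_cv_locally_uniformly phi ->
  (forall n : nat, filterlim (phi n) (at_right 0) (locally (phi n 0))) ->
  radius_fun M phi 0 < 0 -> 0 < r < 1 -> 0 <= radius_fun M phi r ->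
  exists rf, radius_root M phi rf.
Proof.
  intros Hpos Hmono Hdiff Hphi H0 Hneg Hr Hge.
  (* [IVT_interv] needs strict signs at both ends; if the value at r is 0, then r is the root. *)
  destruct (Rle_lt_or_eq_dec _ _ Hge) as [Hgt|Heq]; [|now exists r].
  destruct (IVT_interv (fun y => radius_fun M phi (Rmax y 0)) 0 r) as [x [Hx Hx0]].
  - intros a Ha; unfold radius_fun.
    apply continuity_pt_minus; [|now apply continuity_pt_const].
    apply continuity_pt_plus.
    + apply continuity_pt_mult.
      * apply (continuity_pt_extend_left (fun y => y)); [| |lra].
        -- intros P HP; now apply filter_le_within.
        -- intros t _; apply ex_derive_id.
      * apply continuity_pt_extend_left; auto; lra.
    + apply continuity_pt_mult; [now apply continuity_pt_const|].
      apply continuity_pt_plus; [now apply continuity_pt_const|].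
      apply continuity_pt_weighted_sum; auto; lra.
  - lra.
  - now rewrite Rmax_right by lra.
  - now rewrite Rmax_left by lra.
  - rewrite Rmax_left in Hx0 by lra.
    exists x; split; [|exact Hx0].
    (* The root is not the endpoint 0, where [radius_fun] is negative. *)
    destruct (Req_dec x 0) as [->|]; lra.
Qed.

(** * The inequality and its failure beyond the root *)

Lemma bohr_inequality_of_le (M : R) (phi : nat -> R -> R) (h g : C -> C)
    (a b : nat -> C) (r : R) :
  0 < M -> (forall (n : nat) (r : R), 0 <= r < 1 -> 0 <= phi n r) ->
  series_cv_locally_uniformly phi ->
  in_PH0 M h g -> has_coefficients h g a b ->
  0 <= r < 1 -> radius_fun M phi r <= 0 ->
  bohr_inequality (harmonic_map h g) a b phi r.
Proof.
  intros HM Hpos Hphi HPH Hab Hr Hrad.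
  assert (Hle : forall n,
    0 <= (Cmod (a (n + 2)%nat) + Cmod (b (n + 2)%nat)) * phi (n + 2)%nat r
      <= 2 * M * weighted_term phi r n).
  { intros n; assert (Hn := Hpos (n + 2)%nat r Hr); split.
    - apply Rmult_le_pos; [|exact Hn].
      generalize (Cmod_ge_0 (a (n + 2)%nat)) (Cmod_ge_0 (b (n + 2)%nat)); lra.
    - unfold weighted_term, Rdiv.
      rewrite (Rmult_comm (phi _ _)), <- Rmult_assoc.
      apply Rmult_le_compat_r; [exact Hn|].
      now apply (PH0_coefficient_bound M h g). }
  assert (Ew := ex_series_weighted phi r Hpos Hphi Hr).
  assert (Ew2 : ex_series (fun n => 2 * M * weighted_term phi r n))
    by now apply (ex_series_scal_l (2 * M) (weighted_term phi r)).
  split.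
  - refine (ex_series_le (V := R_CompleteNormedModule) _ _ _ Ew2).
    intros n; change (Rabs ((Cmod (a (n + 2)%nat) + Cmod (b (n + 2)%nat))
       * phi (n + 2)%nat r) <= 2 * M * weighted_term phi r n).
    rewrite Rabs_pos_eq; apply Hle.
  (* By [growth_bound_1], [radius_fun M phi r <= 0] says exactly that r [phi 0](r) + 2M
     [weighted_sum phi r] is at most this value, which separates the two sides. *)
  - apply Rbar_le_trans with (Finite (growth_bound M 1)).
    + simpl; rewrite growth_bound_1.
      assert (H := Series_le _ _ Hle Ew2); rewrite Series_scal_l in H.
      unfold radius_fun in Hrad; unfold Series2.
      change (weighted_sum phi r) with (Series (weighted_term phi r)) in Hrad; lra.
    + apply dist_to_boundary_ge; [apply continuity_pt_growth_bound|].
      intros z Hz; now apply (PH0_growth M h g a b).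
Qed.

(** The coefficient bounds are equalities here and the distance is at most [growth_bound M 1], so it
    is the inequality that breaks, not the convergence of its left side. *)
Lemma bohr_inequality_extremal (M : R) (phi : nat -> R -> R) (r : R) :
  0 < M -> 0 <= growth_bound M 1 -> 0 < radius_fun M phi r ->
  ~ bohr_inequality (harmonic_map (extremal M) (fun _ => RtoC 0))
      (extremal_coefficient M) (fun _ => RtoC 0) phi r.
Proof.
  intros HM HL Hrad [_ H].
  assert (H' := Rbar_le_trans _ _ _ H (dist_to_boundary_extremal M HM HL)).
  simpl in H'; rewrite growth_bound_1 in H'.
  replace (Series2 _) with (2 * M * weighted_sum phi r) in H'.
  - unfold radius_fun in Hrad; lra.
  - unfold weighted_sum, Series2; rewrite <- Series_scal_l.
    apply Series_ext; intros n.
    rewrite Cmod_extremal_coefficient, Cmod_0 by exact HM.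
    unfold Rdiv; ring.
Qed.

Theorem theorem2p1 (M : R) (phi : nat -> R -> R)
  (M_pos : 0 < M)
  (M_lt : M < 1 / (2 * (ln 4 - 1)))
  (phi_nonneg : forall (n : nat) (r : R), 0 <= r < 1 -> 0 <= phi n r)
  (phi_incr : forall n : nat, nondecreasing_on_01 (phi n))
  (phi_diff : forall (n : nat) (r : R), 0 < r < 1 -> ex_derive (phi n) r)
  (phi_cv : series_cv_locally_uniformly phi)
  (phi_at_0 : weighted_sum phi 0 < 1 / (2 * M) + 1 - 2 * ln 2) :
  (* existence of the root *)
  ((forall n : nat, filterlim (phi n) (at_right 0) (locally (phi n 0))) ->
   (exists r : R, 0 < r < 1 /\ 0 <= radius_fun M phi r) ->
   exists rf : R, radius_root M phi rf)
  /\
  (* uniqueness of the root *)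
  ((0 < phi 0%nat 0 \/
    exists n : nat, n <> 1%nat /\ strictly_increasing_on_01 (phi n)) ->
   forall rf rf' : R,
     radius_root M phi rf -> radius_root M phi rf' -> rf = rf')
  /\
  (* the inequality up to the root, and its sharpness *)
  (forall rf : R, unique (radius_root M phi) rf ->
     (forall (h g : C -> C) (a b : nat -> C),
        in_PH0 M h g -> has_coefficients h g a b ->
        forall r : R, 0 <= r <= rf ->
          bohr_inequality (harmonic_map h g) a b phi r)
     /\
     (forall rho : R, rf < rho ->
        exists (h g : C -> C) (a b : nat -> C),
          in_PH0 M h g /\ has_coefficients h g a b /\
          exists r : R, 0 <= r < 1 /\ r <= rho /\
            ~ bohr_inequality (harmonic_map h g) a b phi r)).
Proof.
  split; [|split].
  - intros H0 [r [Hr Hge]].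
    apply (radius_root_exists M phi r); auto.
    (* Multiplied by 2M, [phi_at_0] says that [radius_fun M phi 0] is negative. *)
    unfold radius_fun.
    apply (Rmult_lt_compat_l (2 * M)) in phi_at_0; [|lra].
    replace (2 * M * (1 / (2 * M) + 1 - 2 * ln 2)) with (1 + 2 * M * (1 - 2 * ln 2))
      in phi_at_0 by (field; lra).
    lra.
  - intros Hst rf rf' [Hr H] [Hr' H'].
    destruct (Rtotal_order rf rf') as [Hlt|[E|Hlt]]; [|exact E|].
    + assert (Hm := radius_fun_strict_mono M phi rf rf' M_pos phi_nonneg phi_incr phi_cv
        Hst ltac:(lra) ltac:(lra)); lra.
    + assert (Hm := radius_fun_strict_mono M phi rf' rf M_pos phi_nonneg phi_incr phi_cv
        Hst ltac:(lra) ltac:(lra)); lra.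
  - intros rf [[Hrf Hrf0] Huniq]; split.
    + intros h g a b HPH Hab r Hr.
      apply (bohr_inequality_of_le M); auto; [lra|].
      rewrite <- Hrf0; apply radius_fun_mono; auto; lra.
    + intros rho Hrho.
      exists (extremal M), (fun _ => RtoC 0), (extremal_coefficient M), (fun _ => RtoC 0).
      split; [now apply extremal_PH0|split; [now apply extremal_has_coefficients|]].
      (* rho may exceed 1, while the point of failure has to lie in (rf, 1). *)
      set (r := (rf + Rmin rho 1) / 2).
      assert (Hr : rf < r < 1 /\ r <= rho).
      { unfold r; generalize (Rmin_l rho 1) (Rmin_r rho 1).
        assert (rf < Rmin rho 1) by (apply Rmin_case; lra); lra. }
      exists r; split; [lra|split; [lra|]].
      apply bohr_inequality_extremal; [exact M_pos| |].
      (* With ln 4 = 2 ln 2, the upper bound on M becomes 2M (2 ln 2 - 1) < 1. *)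
      * rewrite growth_bound_1.
        replace 4 with (2 * 2) in M_lt by ring; rewrite ln_mult in M_lt by lra.
        assert (Hl : 0 < 2 * (ln 2 + ln 2 - 1)) by (generalize ln_lt_2; lra).
        apply (Rmult_lt_compat_r _ _ _ Hl) in M_lt.
        replace (1 / (2 * (ln 2 + ln 2 - 1)) * (2 * (ln 2 + ln 2 - 1))) with 1
          in M_lt by (field; lra).
        lra.
      (* Monotonicity gives a nonnegative value at r; a zero there would be a second root. *)
      * assert (Hm := radius_fun_mono M phi rf r M_pos phi_nonneg phi_incr phi_cv
          ltac:(lra) ltac:(lra)).
        destruct (Rle_lt_or_eq_dec _ _ Hm) as [Hlt|E]; [lra|].
        assert (rf = r) by (apply Huniq; split; lra); lra.
Qed.
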